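(* For all $(q,r)\in\mathbb{B}^+\times\mathbb{B}^+$, $$K_{BF}^{\mathbb{B}^+}(q,r)=K_{BF}^{\mathbb{B}}(q,r)+K_{BF}^{\mathbb{H}^+}(q,r).$$ Furthermore, the Bergman-Fueter kernel $K_{BF}^{\mathbb{B}^+}$ is Fueter regular in $q$ and slice anti-regular in $r$ on $\mathbb{B}^+$.
   Context: $\mathbb{H}$ denotes the quaternions, $\mathbb{S}=\{I\in\mathbb{H}:I^2=-1\}$, $\mathbb{C}_I=\mathbb{R}+\mathbb{R}I$, $\mathbb{B}=\{|q|<1\}$, $\mathbb{H}^+=\{\mathrm{Re}(q)>0\}$, $\mathbb{B}^+=\mathbb{B}\cap\mathbb{H}^+$. For $U$ one of these domains and $r\in U\cap\mathbb{C}_J$, the slice Bergman kernel is $K_U(q,r)=\mathrm{ext}[K_{U_J}(\cdot,r)](q)$, where $K_{U_J}$ is the complex Bergman kernel of $U_J=U\cap\mathbb{C}_J$ for the measure $\frac1\pi dx\,dy$ (explicitly $(1-z\overline r)^{-2}$ for $\mathbb{B}_J$, $(z+\overline r)^{-2}$ for $\mathbb{H}^+\cap\mathbb{C}_J$, and the sum of these two for $\mathbb{B}^+_J$), and, with $q=x+I_qy$, $z=x+Jy$, $\mathrm{ext}[g](q)=\frac12\left(g(z)+g(\overline z)\right)+\frac{I_qJ}{2}\left(g(\overline z)-g(z)\right)$. The Bergman-Fueter kernel of $U$ is $K_{BF}^U(q,r)=\Delta K_U(q,r)$ with $\Delta$ the Laplacian on $\mathbb{R}^4\cong\mathbb{H}$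 in the variable $q=x_0+x_1i+x_2j+x_3k$. A function $f$ is Fueter regular if $(\partial_{x_0}+i\partial_{x_1}+j\partial_{x_2}+k\partial_{x_3})f=0$. A function $f$ is (left) slice hyperholomorphic if it is real differentiable and $(\partial_x+I\partial_y)f(x+Iy)=0$ for every $I\in\mathbb{S}$; $F$ is slice anti-regular in $r$ if $r\mapsto\overline{F(r)}$ is left slice hyperholomorphic (as for series $\sum_k a_k\overline r^{\,k}$ with $a_k\in\mathbb{H}$). *)

(* Defs.v *)
From HB Require Import structures.
From mathcomp Require Import all_boot all_order all_algebra.
From mathcomp Require Import ring lra.
From mathcomp Require Import all_classical all_reals all_analysis.

Set Implicit Arguments.
Unset Strict Implicit.
Unset Printing Implicit Defensive.

Import Order.TTheory GRing.Theory Num.Theory.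
Import numFieldNormedType.Exports.

Local Open Scope classical_set_scope.
Local Open Scope ring_scope.

(* Quaternions x0 + x1 i + x2 j + x3 k are the row vectors (x0, x1, x2, x3);
   the topology and the differential calculus are those of 'rV[R]_4.
   The norm `|q| inherited from 'rV[R]_4 is the maximum norm: the modulus of a
   quaternion is [qabs q] below. *)
Definition quat (R : realType) : Type := 'rV[R]_4.

HB.instance Definition _ (R : realType) := NormedModule.copy (quat R) 'rV[R]_4.

Section Quaternion.
Variable R : realType.
Implicit Types (a : R) (p q : quat R).

Definition mkquat (a b c d : R) : quat R :=
  \row_(n < 4) [:: a; b; c; d]`_n.

Definition q0 q : R := q 0 (inord 0).
Definition q1 q : R := q 0 (inord 1).
Definition q2 q : R := q 0 (inord 2).
Definition q3 q : R := q 0 (inord 3).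

Lemma q0E a b c d : q0 (mkquat a b c d) = a.
Proof. by rewrite /q0 mxE inordK. Qed.
Lemma q1E a b c d : q1 (mkquat a b c d) = b.
Proof. by rewrite /q1 mxE inordK. Qed.
Lemma q2E a b c d : q2 (mkquat a b c d) = c.
Proof. by rewrite /q2 mxE inordK. Qed.
Lemma q3E a b c d : q3 (mkquat a b c d) = d.
Proof. by rewrite /q3 mxE inordK. Qed.

Lemma quatP p q :
  q0 p = q0 q -> q1 p = q1 q -> q2 p = q2 q -> q3 p = q3 q -> p = q.
Proof.
move=> e0 e1 e2 e3; apply/rowP => i.
have -> : i = inord i by rewrite inord_val.
by case: i => [] [|[|[|[|//]]]] ?.
Qed.

Lemma q0D p q : q0 (p + q) = q0 p + q0 q. Proof. by rewrite /q0 mxE. Qed.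
Lemma q1D p q : q1 (p + q) = q1 p + q1 q. Proof. by rewrite /q1 mxE. Qed.
Lemma q2D p q : q2 (p + q) = q2 p + q2 q. Proof. by rewrite /q2 mxE. Qed.
Lemma q3D p q : q3 (p + q) = q3 p + q3 q. Proof. by rewrite /q3 mxE. Qed.
Lemma q0N q : q0 (- q) = - q0 q. Proof. by rewrite /q0 mxE. Qed.
Lemma q1N q : q1 (- q) = - q1 q. Proof. by rewrite /q1 mxE. Qed.
Lemma q2N q : q2 (- q) = - q2 q. Proof. by rewrite /q2 mxE. Qed.
Lemma q3N q : q3 (- q) = - q3 q. Proof. by rewrite /q3 mxE. Qed.
Lemma q0Z a q : q0 (a *: q) = a * q0 q. Proof. by rewrite /q0 mxE. Qed.
Lemma q1Z a q : q1 (a *: q) = a * q1 q. Proof. by rewrite /q1 mxE. Qed.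
Lemma q2Z a q : q2 (a *: q) = a * q2 q. Proof. by rewrite /q2 mxE. Qed.
Lemma q3Z a q : q3 (a *: q) = a * q3 q. Proof. by rewrite /q3 mxE. Qed.
Lemma q00 : q0 0 = 0. Proof. by rewrite /q0 mxE. Qed.
Lemma q10 : q1 0 = 0. Proof. by rewrite /q1 mxE. Qed.
Lemma q20 : q2 0 = 0. Proof. by rewrite /q2 mxE. Qed.
Lemma q30 : q3 0 = 0. Proof. by rewrite /q3 mxE. Qed.

Definition quat_linE :=
  (q0E, q1E, q2E, q3E, q0D, q1D, q2D, q3D, q0N, q1N, q2N, q3N,
   q0Z, q1Z, q2Z, q3Z, q00, q10, q20, q30).

Definition qone : quat R := mkquat 1 0 0 0.

Definition qmul p q : quat R :=
  mkquat (q0 p * q0 q - q1 p * q1 q - q2 p * q2 q - q3 p * q3 q)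
         (q0 p * q1 q + q1 p * q0 q + q2 p * q3 q - q3 p * q2 q)
         (q0 p * q2 q - q1 p * q3 q + q2 p * q0 q + q3 p * q1 q)
         (q0 p * q3 q + q1 p * q2 q - q2 p * q1 q + q3 p * q0 q).

Fact qmulA : associative qmul.
Proof. by move=> p q r; apply: quatP; rewrite /qmul !quat_linE; ring. Qed.

Fact qmul1q : left_id qone qmul.
Proof. by move=> q; apply: quatP; rewrite /qmul /qone !quat_linE; ring. Qed.

Fact qmulq1 : right_id qone qmul.
Proof. by move=> q; apply: quatP; rewrite /qmul /qone !quat_linE; ring. Qed.

Fact qmulDl : left_distributive qmul +%R.
Proof. by move=> p q r; apply: quatP; rewrite /qmul !quat_linE; ring. Qed.

Fact qmulDr : right_distributive qmul +%R.
Proof. by move=> p q r; apply: quatP; rewrite /qmul !quat_linE; ring. Qed.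

Fact qone_neq0 : qone != 0.
Proof.
by apply/eqP => /(congr1 q0)/eqP; rewrite /qone !quat_linE oner_eq0.
Qed.

HB.instance Definition _ := GRing.Zmodule_isNzRing.Build (quat R)
  qmulA qmul1q qmulq1 qmulDl qmulDr qone_neq0.

Lemma quat_mulE p q : p * q = qmul p q. Proof. by []. Qed.
Lemma quat_oneE : 1 = qone. Proof. by []. Qed.

Fact qscaleAl a p q : a *: (p * q) = (a *: p) * q.
Proof. by apply: quatP; rewrite !quat_mulE /qmul !quat_linE; ring. Qed.

HB.instance Definition _ := GRing.Lmodule_isLalgebra.Build R (quat R) qscaleAl.

Fact qscaleAr a p q : a *: (p * q) = p * (a *: q).
Proof. by apply: quatP; rewrite !quat_mulE /qmul !quat_linE; ring. Qed.

HB.instance Definition _ := GRing.Lalgebra_isAlgebra.Build R (quat R) qscaleAr.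

Definition qconj q : quat R := mkquat (q0 q) (- q1 q) (- q2 q) (- q3 q).

Definition qsqr q : R := q0 q ^+ 2 + q1 q ^+ 2 + q2 q ^+ 2 + q3 q ^+ 2.

Definition qabs q : R := Num.sqrt (qsqr q).

Definition qinv q : quat R := (qsqr q)^-1 *: qconj q.

Lemma qsqr_eq0 q : (qsqr q == 0) = (q == 0).
Proof.
apply/eqP/eqP => [|->]; last by rewrite /qsqr !quat_linE !expr0n /= !addr0.
move/eqP; rewrite /qsqr !paddr_eq0 ?addr_ge0 ?sqr_ge0 // !sqrf_eq0.
move=> /andP[/andP[/andP[/eqP e0 /eqP e1] /eqP e2] /eqP e3].
by apply: quatP; rewrite ?quat_linE.
Qed.

Lemma mul_qconj q : qconj q * q = (qsqr q)%:A.
Proof.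
apply: quatP;
  rewrite quat_mulE quat_oneE /qmul /qone /qconj /qsqr !quat_linE; ring.
Qed.

Lemma mulq_conj q : q * qconj q = (qsqr q)%:A.
Proof.
apply: quatP;
  rewrite quat_mulE quat_oneE /qmul /qone /qconj /qsqr !quat_linE; ring.
Qed.

Fact qmulVq : {in [pred q | q != 0], left_inverse 1 qinv *%R}.
Proof.
move=> q; rewrite inE -qsqr_eq0 => q_neq0.
by rewrite -scalerAl mul_qconj scalerA mulVf // scale1r.
Qed.

Fact qmulqV : {in [pred q | q != 0], right_inverse 1 qinv *%R}.
Proof.
move=> q; rewrite inE -qsqr_eq0 => q_neq0.
by rewrite -scalerAr mulq_conj scalerA mulVf // scale1r.
Qed.

Fact qunitP p q : q * p = 1 /\ p * q = 1 -> [pred q | q != 0] p.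
Proof.
move=> [e _] /=; apply/eqP => p0; move: e; rewrite p0 mulr0 => /eqP.
by rewrite eq_sym oner_eq0.
Qed.

Fact qinv_out : {in [predC [pred q | q != 0]], qinv =1 id}.
Proof.
move=> q; rewrite !inE negbK => /eqP ->.
by apply: quatP; rewrite /qinv /qconj !quat_linE ?oppr0 ?mulr0.
Qed.

HB.instance Definition _ := GRing.NzRing_hasMulInverse.Build (quat R)
  qmulVq qmulqV qunitP qinv_out.

Definition qi : quat R := mkquat 0 1 0 0.
Definition qj : quat R := mkquat 0 0 1 0.
Definition qk : quat R := mkquat 0 0 0 1.

Definition qim q : quat R := q - (q0 q)%:A.

Definition imsphere : set (quat R) := [set I | I ^+ 2 = -1].

Definition ball4 : set (quat R) := [set q | qabs q < 1].
Definition halfspace4 : set (quat R) := [set q | 0 < q0 q].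
Definition halfball4 : set (quat R) := ball4 `&` halfspace4.

(* An imaginary unit I_q with q = q0 q + I_q * qabs (qim q). For real q every
   imaginary unit qualifies and [qi] is an arbitrary choice; [slice_kernelE]
   shows that the kernels below do not depend on the choices made for q and
   r. *)
Definition iunit q : quat R :=
  if qim q == 0 then qi else (qabs (qim q))^-1 *: qim q.

(* The slice extension of a function g on the plane C_J; only the values of g
   on C_J are used. *)
Definition qext (J : quat R) (g : quat R -> quat R) q : quat R :=
  let x := q0 q in
  let y := qabs (qim q) in
  let z := x%:A + y *: J in
  let zbar := x%:A - y *: J in
  2^-1 *: (g z + g zbar) + 2^-1 *: (iunit q * J * (g zbar - g z)).

(* The complex Bergman kernels, for the measure (1/pi) dx dy, of the slices
   by C_J of the unit ball, of the right half-space and of the right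
   half-ball. They are meant for z and r in one common plane C_J, which is a
   field inside [quat R], and take their values in C_J. *)
Definition bergman_disk (z r : quat R) : quat R := (1 - z * qconj r) ^- 2.
Definition bergman_halfplane (z r : quat R) : quat R := (z + qconj r) ^- 2.
Definition bergman_halfdisk (z r : quat R) : quat R :=
  (1 - z * qconj r) ^- 2 + (z + qconj r) ^- 2.

Definition slice_kernel (k : quat R -> quat R -> quat R) q r : quat R :=
  qext (iunit r) (k^~ r) q.

Lemma imsphereP (I : quat R) : imsphere I <-> q0 I = 0 /\ qsqr I = 1.
Proof.
rewrite /imsphere /= expr2 quat_mulE quat_oneE; split => [e|[e0 es]]; last first.
  move: es; rewrite /qsqr e0 => es.
  by apply: quatP; rewrite /qmul /qone !quat_linE ?e0; lra.
have := (congr1 q0 e, congr1 q1 e, congr1 q2 e, congr1 q3 e).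
rewrite /qmul /qone !quat_linE => -[[[e0 e1] e2] e3].
have h : q0 I = 0 by nra.
by split => //; rewrite /qsqr; move: e0; rewrite h => e0; lra.
Qed.

Lemma qsqrZ (a : R) q : qsqr (a *: q) = a ^+ 2 * qsqr q.
Proof. by rewrite /qsqr !quat_linE; ring. Qed.

Lemma imsphereN (I : quat R) : imsphere I -> imsphere (- I).
Proof. by rewrite /imsphere /= sqrrN. Qed.

Lemma qextE (J : quat R) g (I : quat R) (x y : R) : imsphere I ->
  let z := x%:A + y *: J in let zbar := x%:A - y *: J in
  qext J g (x%:A + y *: I) =
  2^-1 *: (g z + g zbar) + 2^-1 *: (I * J * (g zbar - g z)).
Proof.
move=> SI z zbar; have /imsphereP[I0 I1] := SI.
have ex : q0 (x%:A + y *: I) = x.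
  by rewrite quat_oneE /qone !quat_linE I0; ring.
have ei : qim (x%:A + y *: I) = y *: I by rewrite /qim ex addrAC subrr add0r.
have I_neq0 : I != 0 by rewrite -qsqr_eq0 I1 oner_eq0.
rewrite /qext /iunit ex ei scaler_eq0 (negPf I_neq0) orbF.
rewrite /qabs qsqrZ I1 mulr1 sqrtr_sqr.
case: (ltgtP y 0) => [y0|y0|y0].
- rewrite ltr0_norm // scalerA invrN mulNr mulVf ?lt_eqF // !scaleN1r.
  rewrite !scaleNr opprK -/z -/zbar [g zbar + _]addrC.
  by rewrite -[g z - _]opprB mulrN !mulNr opprK.
- by rewrite gtr0_norm // scalerA mulVf ?gt_eqF // scale1r.
- by rewrite /z /zbar y0 normr0 !scale0r oppr0 addr0 subrr !mulr0.
Qed.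

(* For real r, k z r lies in R + R J with real components that do not depend on
   the plane C_J containing z. *)
Definition real_intrinsic (k : quat R -> quat R -> quat R) := forall a x y : R,
  exists u v : R, forall J : quat R, imsphere J ->
   k (x%:A + y *: J) a%:A = u%:A + v *: J.

Lemma slice_kernelE k (I J : quat R) (x y a b : R) : real_intrinsic k ->
  imsphere I -> imsphere J ->
  let q := x%:A + y *: I in let r := a%:A + b *: J in
  let z := x%:A + y *: J in let zbar := x%:A - y *: J in
  slice_kernel k q r =
  2^-1 *: (k z r + k zbar r) + 2^-1 *: (I * J * (k zbar r - k z r)).
Proof.
move=> kP SI SJ q r z zbar; rewrite /slice_kernel qextE //.
have /imsphereP[J0 J1] := SJ.
have ex : q0 r = a by rewrite /r quat_oneE /qone !quat_linE J0; ring.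
have ei : qim r = b *: J by rewrite /qim ex /r addrAC subrr add0r.
have J_neq0 : J != 0 by rewrite -qsqr_eq0 J1 oner_eq0.
rewrite /iunit ei scaler_eq0 (negPf J_neq0) orbF /qabs qsqrZ J1 mulr1 sqrtr_sqr.
case: (ltgtP b 0) => [b0|b0|b0].
- have -> : `|b|^-1 *: (b *: J) = - J.
    by rewrite ltr0_norm // scalerA invrN mulNr mulVf ?lt_eqF // scaleN1r.
  rewrite !scalerN opprK -/z -/zbar [k zbar r + _]addrC.
  by rewrite -[k z r - _]opprB !mulrN mulNr opprK.
- have -> : `|b|^-1 *: (b *: J) = J; last by [].
    by rewrite gtr0_norm // scalerA mulVf ?gt_eqF // scale1r.
- rewrite /zbar /z /r b0 scale0r addr0 -!scalerN.
  have [u [v uv]] := kP a x y.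
  have Sqi : imsphere qi.
    by apply/imsphereP; split; rewrite /qsqr /qi !quat_linE //; ring.
  rewrite !uv //; try exact: imsphereN.
  have h (L : quat R) : imsphere L ->
     2^-1 *: (u%:A + v *: L + (u%:A + v *: - L))
     + 2^-1 *: (I * L * (u%:A + v *: - L - (u%:A + v *: L))) = u%:A + v *: I.
    move=> SL; rewrite !scalerN addrACA subrr addr0 opprD addrACA subrr add0r.
    have h2 (w : quat R) : 2^-1 *: (w + w) = w.
      by rewrite -mulr2n -(scaler_nat 2 w) scalerA mulVf ?scale1r // pnatr_eq0.
    by rewrite mulrDr !mulrN -!scalerAr -mulrA -expr2 SL mulrN1 scalerN opprK !h2.
  by rewrite !h.
Qed.

Lemma real_qconj (a : R) : qconj (a%:A : quat R) = a%:A.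
Proof. by apply: quatP; rewrite quat_oneE /qconj /qone !quat_linE; ring. Qed.

Lemma sqr_slice (J : quat R) (s t : R) : imsphere J ->
  (s%:A - t *: J) * (s%:A - t *: J) =
  (s ^+ 2 - t ^+ 2)%:A + (- 2 * s * t) *: J.
Proof.
move=> SJ; have JJ : J * J = -1 by [].
rewrite mulrBl !mulrBr; set e := (- 2 * s * t) *: J.
rewrite -!scalerAl !mul1r -!scalerAr !mulr1 JJ.
by apply: quatP; rewrite /e quat_oneE /qone !quat_linE; ring.
Qed.

Lemma real_intrinsic_sq (c d : R -> R) :
  real_intrinsic (fun z r => ((c (q0 r))%:A + d (q0 r) *: z) ^- 2).
Proof.
move=> a x y; pose s := c a + d a * x; pose t := d a * y.
pose n := (s ^+ 2 + t ^+ 2)^-1.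
exists (n ^+ 2 * (s ^+ 2 - t ^+ 2)), (n ^+ 2 * (- 2 * s * t)) => J SJ.
have /imsphereP[J0 J1] := SJ.
have -> : q0 (a%:A : quat R) = a by rewrite quat_oneE /qone !quat_linE mulr1.
have -> : (c a)%:A + d a *: (x%:A + y *: J) = s%:A + t *: J.
  by rewrite scalerDr addrA !scalerA -scalerDl.
set w := s%:A + t *: J.
have wE : w^-1 = n *: (s%:A - t *: J).
  have sw : qsqr w = s ^+ 2 + t ^+ 2.
    rewrite /w /qsqr quat_oneE /qone !quat_linE J0.
    have := J1; rewrite /qsqr J0 => e; nra.
  have cw : qconj w = s%:A - t *: J.
    by apply: quatP; rewrite /w /qconj quat_oneE /qone !quat_linE ?J0; ring.
  by rewrite /n -sw -cw.
have -> : w ^- 2 = (w^-1) ^+ 2 by rewrite exprVn.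
have sq := sqr_slice s t SJ.
by rewrite wE expr2 -scalerAl -scalerAr sq !scalerA -expr2 scalerDr !scalerA.
Qed.
Lemma real_intrinsic_disk : real_intrinsic (bergman_disk).
Proof.
move=> a x y.
have [u [v uv]] := real_intrinsic_sq (cst 1) -%R a x y.
exists u, v => J SJ; rewrite -uv // /bergman_disk real_qconj.
rewrite /cst scale1r -scalerAr mulr1.
by rewrite quat_oneE /qone /= !quat_linE mulr1 scaleNr.
Qed.
Lemma real_intrinsic_halfplane : real_intrinsic (bergman_halfplane).
Proof.
move=> a x y.
have [u [v uv]] := real_intrinsic_sq id (cst 1) a x y.
exists u, v => J SJ; rewrite -uv // /bergman_halfplane real_qconj.
by rewrite /cst scale1r addrC quat_oneE /qone !quat_linE mulr1.
Qed.
Lemma real_intrinsic_halfdisk : real_intrinsic (bergman_halfdisk).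
Proof.
move=> a x y; have [u1 [v1 uv1]] := real_intrinsic_disk a x y.
have [u2 [v2 uv2]] := real_intrinsic_halfplane a x y.
exists (u1 + u2), (v1 + v2) => J SJ; rewrite !scalerDl addrACA -uv1 // -uv2 //.
Qed.

Definition K_ball := slice_kernel bergman_disk.
Definition K_halfspace := slice_kernel bergman_halfplane.
Definition K_halfball := slice_kernel bergman_halfdisk.

Definition laplacian (f : quat R -> quat R) q : quat R :=
  'D_1 ('D_1 f) q + 'D_qi ('D_qi f) q
  + 'D_qj ('D_qj f) q + 'D_qk ('D_qk f) q.

Definition KBF_ball q r : quat R := laplacian (K_ball^~ r) q.
Definition KBF_halfspace q r : quat R := laplacian (K_halfspace^~ r) q.
Definition KBF_halfball q r : quat R := laplacian (K_halfball^~ r) q.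

Definition fueter_regular (U : set (quat R)) (f : quat R -> quat R) : Prop :=
  forall q, U q -> differentiable f q /\
    'D_1 f q + qi * 'D_qi f q + qj * 'D_qj f q + qk * 'D_qk f q = 0.

Definition slice_hyperholomorphic (U : set (quat R)) (f : quat R -> quat R)
    : Prop :=
  (forall q, U q -> differentiable f q) /\
  (forall (I : quat R) (x y : R), imsphere I -> U (x%:A + y *: I) ->
    (fun t : R => f (t%:A + y *: I))^`()%classic x
    + I * (fun t : R => f (x%:A + t *: I))^`()%classic y = 0).

Definition slice_antiregular (U : set (quat R)) (F : quat R -> quat R) : Prop :=
  slice_hyperholomorphic U (fun r => qconj (F r)).

End Quaternion.

(* Main.v *)
Require Import Defs.
From HB Require Import structures.
From mathcomp Require Import all_boot all_order all_algebra.
From mathcomp Require Import ring lra.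
From mathcomp Require Import all_classical all_reals all_analysis.
From mathcomp Require Import complex.

Set Implicit Arguments.
Unset Strict Implicit.
Unset Printing Implicit Defensive.

Import Order.TTheory GRing.Theory Num.Theory.
Import numFieldNormedType.Exports.

Local Open Scope classical_set_scope.
Local Open Scope ring_scope.

(** Write [cr] for the conjugate of [r] and let [J] be an imaginary unit whose
    plane contains [r].  On that plane the kernels of the ball and of the
    half-space have the same shape, [(al + z be) ^- 2] with [al], [be] in the
    plane: [(al, be)] is [(1, - cr)] for the ball and [(cr, 1)] for the
    half-space, and the kernel of the half-ball is the sum of the two.

    Put [x = q0 q], [v = qim q], [s = |v| ^ 2], [u = al + x be] and
    [N = u ^ 2 + s be ^ 2].  If [z] in the plane has the same real part and
    the same modulus of the imaginary part as [q], then
    [N = (al + z be) (al + zbar be)], which is insensitive to the sign of the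
    imaginary part of [z].  Multiplying numerator and denominator of the kernel
    by [(al + zbar be) ^ 2] therefore leaves a denominator on which the slice
    extension does nothing, and the extension is [A + v B] with
    [A = 2 u ^ 2 N ^- 2 - N ^- 1] and [B = - 2 be u N ^- 2]: this is
    [qext_kernel].  Here [A] and [B] take values in the plane and depend on [q]
    only through [x] and [s].

    For such an axial function [A + v B] the Laplacian and the Dirac operator
    are expressed by the partial derivatives of [A] and [B] in [x] and [s]
    ([laplacian_axial], [dirac_axial]).  The profiles are sums of monomials
    [c u ^ m N ^- n], a class closed under both partial derivatives
    ([has_axial_mono]), so what remains are identities of rational functions in
    the commutative field of complex numbers.  They give
    [4 be ^ 2 (N ^- 2 - 4 u ^ 2 N ^- 3) + v 16 be ^ 3 u N ^- 3] for the
    Laplacian of the kernel, and zero when the Dirac operator is applied once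
    more.  On the half-ball neither [1 - z cr] nor [z + cr] vanishes, so the
    formulas hold there, and additivity of the extension and of the Laplacian
    gives the sum formula and the Fueter regularity.

    For the dependence on [r], the same formula read with quaternions
    [(al, be)] no longer mentions [J]: it is a rational function of [cr]
    ([bergman_fueter_closed]), hence differentiable in [r].  On each plane [C_I]
    its conjugate is [a(r) + b(r) v'], where [v'] is the conjugate of [v] and
    [a], [b] are rational functions of [r] with real coefficients; they satisfy
    the Cauchy-Riemann equation with [I] acting on the left, and multiplication
    by [v'] on the right does not affect it. *)


(** * Differential calculus of quaternion-valued functions *)

Section QuatCalculus.
Variables (R : realType) (V : normedModType R).
Implicit Types (f g : V -> quat R) (p w : V).

Lemma is_derive_quat f p w (d : quat R) :
  is_derive p w (fun x => q0 (f x)) (q0 d) ->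
  is_derive p w (fun x => q1 (f x)) (q1 d) ->
  is_derive p w (fun x => q2 (f x)) (q2 d) ->
  is_derive p w (fun x => q3 (f x)) (q3 d) -> is_derive p w f d.
Proof.
move=> [h0 e0] [h1 e1] [h2 e2] [h3 e3].
have fd : derivable f p w.
  apply/derivable_mxP => k j; rewrite (ord1 k).
  have -> : j = inord j by rewrite inord_val.
  case: j => [] [|[|[|[|j]]]] /= jlt.
  - exact: h0.
  - exact: h1.
  - exact: h2.
  - exact: h3.
  - discriminate jlt.
apply: DeriveDef => //.
apply: quatP; rewrite derive_mx // /q0 /q1 /q2 /q3 mxE;
 [exact: e0|exact: e1|exact: e2|exact: e3].
Qed.

Let is_derive_entry f p w (d : quat R) (i : 'I_4) : is_derive p w f d ->
  is_derive p w (fun x => f x 0 i) (d 0 i).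
Proof.
move=> [fd <-]; apply: DeriveDef; first by move/derivable_mxP : fd; apply.
by rewrite derive_mx // mxE.
Qed.

Lemma is_derive_coords f p w (d : quat R) : is_derive p w f d ->
  [/\ is_derive p w (fun x => q0 (f x)) (q0 d),
      is_derive p w (fun x => q1 (f x)) (q1 d),
      is_derive p w (fun x => q2 (f x)) (q2 d) &
      is_derive p w (fun x => q3 (f x)) (q3 d)].
Proof.
by move=> h; split;
  [exact: (is_derive_entry (inord 0) h)|exact: (is_derive_entry (inord 1) h)|
   exact: (is_derive_entry (inord 2) h)|exact: (is_derive_entry (inord 3) h)].
Qed.

(** The next four rules are the derivation rules for pointwise sums and
    products, written with the argument displayed so that they can be chained
    into the derivative of a given expression. *)
Lemma is_deriveMr (f g : V -> R) p w (df dg : R) :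
  is_derive p w f df -> is_derive p w g dg ->
  is_derive p w (fun x => f x * g x) (f p * dg + g p * df).
Proof. exact: is_deriveM. Qed.

Lemma is_deriveDl (W : normedModType R) (f g : V -> W) p w (df dg : W) :
  is_derive p w f df -> is_derive p w g dg ->
  is_derive p w (fun x => f x + g x) (df + dg).
Proof. exact: is_deriveD. Qed.

Lemma is_deriveNl (W : normedModType R) (f : V -> W) p w (df : W) :
  is_derive p w f df -> is_derive p w (fun x => - f x) (- df).
Proof. exact: is_deriveN. Qed.

Lemma is_deriveBl (W : normedModType R) (f g : V -> W) p w (df dg : W) :
  is_derive p w f df -> is_derive p w g dg ->
  is_derive p w (fun x => f x - g x) (df - dg).
Proof. exact: is_deriveB. Qed.

Lemma is_derive_qmul f g p w (df dg : quat R) :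
  is_derive p w f df -> is_derive p w g dg ->
  is_derive p w (fun x => f x * g x) (f p * dg + df * g p).
Proof.
move=> /is_derive_coords[f0 f1 f2 f3] /is_derive_coords[g0 g1 g2 g3].
apply: is_derive_quat; rewrite !quat_mulE /qmul !quat_linE;
  (under eq_fun do rewrite quat_mulE /qmul !quat_linE).
- apply: is_derive_eq (is_deriveBl (is_deriveBl (is_deriveBl
    (is_deriveMr f0 g0) (is_deriveMr f1 g1)) (is_deriveMr f2 g2))
    (is_deriveMr f3 g3)) _; ring.
- apply: is_derive_eq (is_deriveBl (is_deriveDl (is_deriveDl
    (is_deriveMr f0 g1) (is_deriveMr f1 g0)) (is_deriveMr f2 g3))
    (is_deriveMr f3 g2)) _; ring.
- apply: is_derive_eq (is_deriveDl (is_deriveDl (is_deriveBl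
    (is_deriveMr f0 g2) (is_deriveMr f1 g3)) (is_deriveMr f2 g0))
    (is_deriveMr f3 g1)) _; ring.
- apply: is_derive_eq (is_deriveDl (is_deriveBl (is_deriveDl
    (is_deriveMr f0 g3) (is_deriveMr f1 g2)) (is_deriveMr f2 g1))
    (is_deriveMr f3 g0)) _; ring.
Qed.

Lemma differentiable_quat f p :
  differentiable (fun x => q0 (f x)) p ->
  differentiable (fun x => q1 (f x)) p ->
  differentiable (fun x => q2 (f x)) p ->
  differentiable (fun x => q3 (f x)) p ->
  differentiable f p.
Proof.
move=> d0 d1 d2 d3.
have fE x : f x = q0 (f x) *: qone R + q1 (f x) *: qi R
                 + q2 (f x) *: qj R + q3 (f x) *: qk R.
  by apply: quatP; rewrite !quat_linE; ring.
rewrite (funext fE).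
exact: (differentiableD (differentiableD (differentiableD
  (differentiableZl _ d0) (differentiableZl _ d1)) (differentiableZl _ d2))
  (differentiableZl _ d3)).
Qed.

Let differentiable_entry f p (i : 'I_4) :
  differentiable f p -> differentiable (fun x => f x 0 i) p.
Proof.
move=> df.
exact: (@differentiable_comp _ _ _ _ f (fun N : 'rV[R]_4 => N 0 i) p df
  (differentiable_coord _ _ _)).
Qed.

Lemma differentiable_coords f p : differentiable f p ->
  [/\ differentiable (fun x => q0 (f x)) p,
      differentiable (fun x => q1 (f x)) p,
      differentiable (fun x => q2 (f x)) p &
      differentiable (fun x => q3 (f x)) p].
Proof.
by move=> h; split;
  [exact: (differentiable_entry (inord 0) h)|
   exact: (differentiable_entry (inord 1) h)|
   exact: (differentiable_entry (inord 2) h)|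
   exact: (differentiable_entry (inord 3) h)].
Qed.

Lemma differentiable_qmul f g p : differentiable f p -> differentiable g p ->
  differentiable (fun x => f x * g x) p.
Proof.
move=> /differentiable_coords[f0 f1 f2 f3] /differentiable_coords[g0 g1 g2 g3].
apply: differentiable_quat; (under eq_fun do rewrite quat_mulE /qmul !quat_linE).
- exact: (differentiableB (differentiableB (differentiableB
    (differentiableM f0 g0) (differentiableM f1 g1)) (differentiableM f2 g2))
    (differentiableM f3 g3)).
- exact: (differentiableB (differentiableD (differentiableD
    (differentiableM f0 g1) (differentiableM f1 g0)) (differentiableM f2 g3))
    (differentiableM f3 g2)).
- exact: (differentiableD (differentiableD (differentiableB
    (differentiableM f0 g2) (differentiableM f1 g3)) (differentiableM f2 g0))
    (differentiableM f3 g1)).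
- exact: (differentiableD (differentiableB (differentiableD
    (differentiableM f0 g3) (differentiableM f1 g2)) (differentiableM f2 g1))
    (differentiableM f3 g0)).
Qed.

Lemma differentiable_qsqr f p : differentiable f p ->
  differentiable (fun x => qsqr (f x)) p.
Proof.
move=> /differentiable_coords[f0 f1 f2 f3].
under eq_fun do rewrite /qsqr !expr2.
exact: (differentiableD (differentiableD (differentiableD
  (differentiableM f0 f0) (differentiableM f1 f1)) (differentiableM f2 f2))
  (differentiableM f3 f3)).
Qed.

Lemma differentiable_qconj f p : differentiable f p ->
  differentiable (fun x => qconj (f x)) p.
Proof.
move=> /differentiable_coords[f0 f1 f2 f3].
apply: differentiable_quat; (under eq_fun do rewrite /qconj !quat_linE).
- exact: f0.
- exact: (differentiableN f1).
- exact: (differentiableN f2).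
- exact: (differentiableN f3).
Qed.

Lemma differentiable_qinv f p : differentiable f p -> f p != 0 ->
  differentiable (fun x => (f x)^-1) p.
Proof.
move=> df fp0; have dn := differentiable_qsqr df.
have dm : differentiable (fun x => (qsqr (f x))^-1) p.
  have n0 : qsqr (f p) != 0 by rewrite qsqr_eq0.
  exact: (differentiableV dn n0).
have [c0 c1 c2 c3] := differentiable_coords (differentiable_qconj df).
have qinvE x : (f x)^-1 = (qsqr (f x))^-1 *: qconj (f x) by [].
rewrite (funext qinvE).
apply: differentiable_quat; (under eq_fun do rewrite ?q0Z ?q1Z ?q2Z ?q3Z).
- exact: (differentiableM dm c0).
- exact: (differentiableM dm c1).
- exact: (differentiableM dm c2).
- exact: (differentiableM dm c3).
Qed.

End QuatCalculus.

(** The Bergman-Fueter kernel is known in closed form only near the points of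
    the half-ball, so differentiability must be transported along an equality
    of germs. *)
Lemma near_eq_differentiable (R : numFieldType) (V W : normedModType R)
    (f g : V -> W) (p : V) :
  (\near p, f p = g p) -> differentiable f p -> differentiable g p.
Proof.
move=> fg df.
have fgp : f p = g p by exact: nbhs_singleton fg.
have key : g \o shift p = cst (g p) + 'd f p +o_ 0 id.
  apply/eqaddoP => e e0.
  have /eqaddoP/(_ e e0) h := diff_locally df.
  have : \forall x \near 0, f (x + p) = g (x + p).
    have := fg; rewrite (near_shift 0) subr0 /=.
    by apply: filterS => x /=; rewrite /shift.
  apply: filterS2 h => x.
  by rewrite !fctE /= fgp => + <-.
apply/diff_locallyP; rewrite (diff_unique _ key) //; last exact: diff_continuous.
split => //; exact: diff_continuous.
Qed.


(** * The complex plane through an imaginary unit *)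

Section SliceEmbedding.
Variable R : realType.
Implicit Types (J : quat R) (z w : R[i]).

(** For an imaginary unit [J] this is the isomorphism of the complex field onto
    the plane [C_J]; it turns identities between commuting quaternions into
    identities in a commutative field. *)
Definition slice_emb J z : quat R := (complex.Re z)%:A + complex.Im z *: J.

Lemma slice_embD J z w : slice_emb J (z + w) = slice_emb J z + slice_emb J w.
Proof. by case: z w => a b [c d]; rewrite /slice_emb /= !scalerDl addrACA. Qed.

Lemma slice_embN J z : slice_emb J (- z) = - slice_emb J z.
Proof. by case: z => a b; rewrite /slice_emb /= !scaleNr opprD. Qed.

Lemma slice_embB J z w : slice_emb J (z - w) = slice_emb J z - slice_emb J w.
Proof. by rewrite slice_embD slice_embN. Qed.

Lemma slice_embR J (x : R) : slice_emb J x%:C%C = x%:A.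
Proof. by rewrite /slice_emb /= scale0r addr0. Qed.

Lemma slice_emb1 J : slice_emb J 1 = 1.
Proof. by rewrite -[1]/(1%:C)%C slice_embR scale1r. Qed.

Lemma slice_emb_unit J : slice_emb J 'i%C = J.
Proof. by rewrite /slice_emb /= scale0r scale1r add0r. Qed.

Lemma slice_embM J z w : imsphere J ->
  slice_emb J (z * w) = slice_emb J z * slice_emb J w.
Proof.
move=> SJ; have JJ : J * J = -1 by [].
case: z w => a b [c d]; rewrite /slice_emb /=.
rewrite mulrDl !mulrDr -!scalerAl -!scalerAr !mul1r !mulr1 JJ.
by apply: quatP; rewrite quat_oneE /qone !quat_linE; ring.
Qed.

Lemma slice_embX J z n : imsphere J ->
  slice_emb J (z ^+ n) = slice_emb J z ^+ n.
Proof.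
move=> SJ; elim: n => [|n IH]; first by rewrite !expr0 slice_emb1.
by rewrite !exprS slice_embM // IH.
Qed.

Lemma slice_embZ J (a : R) z : slice_emb J (a%:C%C * z) = a *: slice_emb J z.
Proof.
by case: z => b c; rewrite /slice_emb /= !mul0r subr0 addr0 scalerDr !scalerA.
Qed.

Lemma slice_embV J z : imsphere J -> slice_emb J z^-1 = (slice_emb J z)^-1.
Proof.
move=> SJ; have [->|z0] := eqVneq z 0.
  by rewrite invr0 -[0 : R[i]]/(0%:C)%C slice_embR scale0r invr0.
have e : slice_emb J z^-1 * slice_emb J z = 1.
  by rewrite -slice_embM // mulVf // slice_emb1.
have u : slice_emb J z \is a GRing.unit.
  rewrite unfold_in /= -/(is_true _).
  by apply/eqP => h; move: e; rewrite h mulr0 => /eqP; rewrite eq_sym oner_eq0.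
by rewrite -[RHS]mul1r -e mulrK.
Qed.

Lemma slice_emb_conj J z : imsphere J ->
  slice_emb J (z^*)%C = qconj (slice_emb J z).
Proof.
move=> /imsphereP[J0 _]; case: z => a b; rewrite /slice_emb /=.
by apply: quatP; rewrite /qconj quat_oneE /qone !quat_linE ?J0; ring.
Qed.

End SliceEmbedding.

(** * Directional derivatives of complex-valued functions *)

Section ComplexDerivative.
Variables (R : realType) (V : normedModType R).
Implicit Types (f g : V -> R[i]) (p w : V).

(** A complex-valued function is differentiated through its real and imaginary
    parts, which keeps the notion independent of the plane [C_J] in which the
    values are placed afterwards. *)
Definition is_cderive p w f (d : R[i]) : Prop :=
  is_derive p w (fun x => complex.Re (f x)) (complex.Re d) /\
  is_derive p w (fun x => complex.Im (f x)) (complex.Im d).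

Lemma is_cderive_eq f p w (d e : R[i]) :
  is_cderive p w f d -> d = e -> is_cderive p w f e.
Proof. by move=> h <-. Qed.

Lemma is_cderive_cst p w (c : R[i]) : is_cderive p w (fun=> c) 0.
Proof. by split; apply: is_derive_cst. Qed.

Lemma is_cderiveR (h : V -> R) p w (d : R) :
  is_derive p w h d -> is_cderive p w (fun x => (h x)%:C%C) d%:C%C.
Proof. by move=> hd; split => //; apply: is_derive_cst. Qed.

Lemma is_cderiveD f g p w (df dg : R[i]) :
  is_cderive p w f df -> is_cderive p w g dg ->
  is_cderive p w (fun x => f x + g x) (df + dg).
Proof.
have ReD (a b : R[i]) : complex.Re (a + b) = complex.Re a + complex.Re b.
  by case: a b => ? ? [].
have ImD (a b : R[i]) : complex.Im (a + b) = complex.Im a + complex.Im b.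
  by case: a b => ? ? [].
move=> [fr fi] [gr gi]; split.
- by under eq_fun do rewrite ReD; rewrite ReD; apply: is_deriveDl.
- by under eq_fun do rewrite ImD; rewrite ImD; apply: is_deriveDl.
Qed.

Lemma is_cderiveM f g p w (df dg : R[i]) :
  is_cderive p w f df -> is_cderive p w g dg ->
  is_cderive p w (fun x => f x * g x) (f p * dg + df * g p).
Proof.
have ReM (a b : R[i]) : complex.Re (a * b) =
    complex.Re a * complex.Re b - complex.Im a * complex.Im b.
  by case: a b => ? ? [].
have ImM (a b : R[i]) : complex.Im (a * b) =
    complex.Re a * complex.Im b + complex.Im a * complex.Re b.
  by case: a b => ? ? [].
move=> [fr fi] [gr gi]; split.
- under eq_fun do rewrite ReM.
  apply: is_derive_eq (is_deriveBl (is_deriveMr fr gr) (is_deriveMr fi gi)) _.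
  by case: (f p) (g p) df dg {fr fi gr gi} => a b [c d] [x y] [z t] /=; ring.
- under eq_fun do rewrite ImM.
  apply: is_derive_eq (is_deriveDl (is_deriveMr fr gi) (is_deriveMr fi gr)) _.
  by case: (f p) (g p) df dg {fr fi gr gi} => a b [c d] [x y] [z t] /=; ring.
Qed.

Lemma is_cderiveN f p w (d : R[i]) :
  is_cderive p w f d -> is_cderive p w (fun x => - f x) (- d).
Proof.
have ReN (a : R[i]) : complex.Re (- a) = - complex.Re a by case: a.
have ImN (a : R[i]) : complex.Im (- a) = - complex.Im a by case: a.
move=> [fr fi]; split.
- by under eq_fun do rewrite ReN; rewrite ReN; apply: is_deriveNl.
- by under eq_fun do rewrite ImN; rewrite ImN; apply: is_deriveNl.
Qed.

Lemma is_cderiveX f n p w (d : R[i]) : is_cderive p w f d ->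
  is_cderive p w (fun x => f x ^+ n) (n%:R * f p ^+ n.-1 * d).
Proof.
move=> hf; elim: n => [|n IH].
  by under eq_fun do rewrite expr0; rewrite !mul0r; apply: is_cderive_cst.
under eq_fun do rewrite exprS.
apply: is_cderive_eq (is_cderiveM hf IH) _.
case: n {IH} => [|n]; first by rewrite !mul0r mulr0 expr0 mulr1 !mul1r add0r.
by rewrite /= exprS -!natr1; ring.
Qed.

Lemma is_cderiveV f p w (d : R[i]) : f p != 0 -> is_cderive p w f d ->
  is_cderive p w (fun x => (f x)^-1) (- ((f p)^-1 ^+ 2 * d)).
Proof.
move=> fp0 [fr fi].
pose n x := complex.Re (f x) ^+ 2 + complex.Im (f x) ^+ 2.
have n0 : n p != 0.
  rewrite /n; move: fp0; case: (f p) => a b /= /negP h; apply/negP => /eqP e.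
  apply: h; have /andP[/eqP -> /eqP ->] : (a == 0) && (b == 0).
    by rewrite -(sqrf_eq0 a) -(sqrf_eq0 b) -paddr_eq0 ?sqr_ge0 // e.
  by [].
have dn := is_deriveDl (is_deriveMr fr fr) (is_deriveMr fi fi).
have nE : (fun x => complex.Re (f x) * complex.Re (f x)
   + complex.Im (f x) * complex.Im (f x)) = n.
  by apply/funext => x; rewrite /n !expr2.
rewrite nE in dn.
have dm : is_derive p w (fun x => (n x)^-1) (- (n p) ^- 2 *
    (complex.Re (f p) * complex.Re d + complex.Re (f p) * complex.Re d
    + (complex.Im (f p) * complex.Im d + complex.Im (f p) * complex.Im d))).
  by case: dn => dn <-; apply: DeriveDef; [exact: derivableV|exact: deriveV].
have ReV (z : R[i]) : complex.Re z^-1 =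
    complex.Re z * (complex.Re z ^+ 2 + complex.Im z ^+ 2)^-1 by case: z.
have ImV (z : R[i]) : complex.Im z^-1 =
    - complex.Im z * (complex.Re z ^+ 2 + complex.Im z ^+ 2)^-1.
  by case: z => a b /=; rewrite mulNr.
split.
- under eq_fun do rewrite ReV.
  apply: is_derive_eq (is_deriveMr fr dm) _.
  rewrite /n in n0 *.
  case: (f p) d n0 {fp0 fr fi dn dm} => a b [x y] /= n0; field.
  by move: n0; rewrite !expr2.
- under eq_fun do rewrite ImV.
  apply: is_derive_eq (is_deriveMr (is_deriveNl fi) dm) _.
  rewrite /n in n0 *.
  case: (f p) d n0 {fp0 fr fi dn dm} => a b [x y] /= n0; field.
  by move: n0; rewrite !expr2.
Qed.

Lemma is_derive_slice_emb J f p w (d : R[i]) : is_cderive p w f d ->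
  is_derive p w (fun x => slice_emb J (f x)) (slice_emb J d).
Proof.
have coordE (i : 'I_4) (z : R[i]) : slice_emb J z 0 i =
    complex.Re z * (1 : quat R) 0 i + complex.Im z * J 0 i.
  by rewrite /slice_emb !mxE.
have cst (c : R) : is_derive p w (fun=> c) 0 by apply: is_derive_cst.
move=> [fr fi]; apply: is_derive_quat; rewrite /q0 /q1 /q2 /q3 coordE;
 (under eq_fun do rewrite coordE);
 apply: is_derive_eq (is_deriveDl (is_deriveMr fr (cst _))
                                  (is_deriveMr fi (cst _))) _; ring.
Qed.

End ComplexDerivative.


(** * Axial functions, their Laplacian and their Dirac derivative *)

Section AxialCalculus.
Variables (R : realType) (J : quat R).
Implicit Types (q w : quat R) (A B : quat R -> R[i]).

(** Identities between sums and products of quaternions are checked on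
    coordinates; naming the coordinates first and then computing with
    [mkquat] leaves four polynomial identities in real variables. *)
Lemma quat_mk q : exists a b c d, q = mkquat a b c d.
Proof.
by exists (q0 q), (q1 q), (q2 q), (q3 q); apply: quatP; rewrite !quat_linE.
Qed.

Lemma mkquatD (a b c d a' b' c' d' : R) :
  mkquat a b c d + mkquat a' b' c' d' =
  mkquat (a + a') (b + b') (c + c') (d + d').
Proof. by apply: quatP; rewrite !quat_linE. Qed.

Lemma mkquatZ (k a b c d : R) :
  k *: mkquat a b c d = mkquat (k * a) (k * b) (k * c) (k * d).
Proof. by apply: quatP; rewrite !quat_linE. Qed.

Lemma mkquatN (a b c d : R) : - mkquat a b c d = mkquat (- a) (- b) (- c) (- d).
Proof. by apply: quatP; rewrite !quat_linE. Qed.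

Lemma mkquatM (a b c d a' b' c' d' : R) :
  mkquat a b c d * mkquat a' b' c' d' =
  mkquat (a * a' - b * b' - c * c' - d * d') (a * b' + b * a' + c * d' - d * c')
         (a * c' - b * d' + c * a' + d * b') (a * d' + b * c' - c * b' + d * a').
Proof. by rewrite quat_mulE /qmul !quat_linE. Qed.

Definition mkquatE := (mkquatD, mkquatZ, mkquatN, mkquatM).

Lemma is_deriveZr (V : normedModType R) (k : V -> R) (f : V -> quat R)
    (p w : V) (dk : R) (df : quat R) :
  is_derive p w k dk -> is_derive p w f df ->
  is_derive p w (fun x => k x *: f x) (k p *: df + dk *: f p).
Proof.
move=> hk /is_derive_coords[f0 f1 f2 f3].
apply: is_derive_quat; (under eq_fun do rewrite !quat_linE);
  rewrite !quat_linE.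
- by apply: is_derive_eq (is_deriveMr hk f0) _; ring.
- by apply: is_derive_eq (is_deriveMr hk f1) _; ring.
- by apply: is_derive_eq (is_deriveMr hk f2) _; ring.
- by apply: is_derive_eq (is_deriveMr hk f3) _; ring.
Qed.

(** The inner product of the imaginary parts: the derivative of
    [|qim q| ^ 2] in the direction [w] is [2 * imdot q w]. *)
Definition imdot q w : R := q1 q * q1 w + q2 q * q2 w + q3 q * q3 w.

Lemma qimE q : qim q = mkquat 0 (q1 q) (q2 q) (q3 q).
Proof.
by apply: quatP; rewrite /qim quat_oneE /qone !quat_linE; ring.
Qed.

Lemma qsqr_qim q : qsqr (qim q) = imdot q q.
Proof. by rewrite qimE /qsqr /imdot !quat_linE; ring. Qed.

Lemma is_derive_q0 q w : is_derive q w (@q0 R) (q0 w).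
Proof. by have [] := is_derive_coords (is_derive_id q w). Qed.

Lemma is_derive_imdot q w e : is_derive q w (imdot^~ e) (imdot w e).
Proof.
have [_ h1 h2 h3] := is_derive_coords (is_derive_id q w).
have cst (c : R) : is_derive q w (fun=> c) 0 by apply: is_derive_cst.
apply: is_derive_eq (is_deriveDl (is_deriveDl (is_deriveMr h1 (cst _))
  (is_deriveMr h2 (cst _))) (is_deriveMr h3 (cst _))) _.
by rewrite /imdot; ring.
Qed.

Lemma is_derive_qim q w : is_derive q w (@qim R) (qim w).
Proof.
have [_ h1 h2 h3] := is_derive_coords (is_derive_id q w).
apply: is_derive_quat; rewrite qimE !quat_linE;
  (under eq_fun do rewrite qimE !quat_linE).
- exact: is_derive_cst.
- exact: h1.
- exact: h2.
- exact: h3.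
Qed.

Lemma is_derive_qsqr_qim q w :
  is_derive q w (fun q => qsqr (qim q)) (2 * imdot q w).
Proof.
have [_ h1 h2 h3] := is_derive_coords (is_derive_id q w).
under eq_fun do rewrite qsqr_qim.
apply: is_derive_eq (is_deriveDl (is_deriveDl (is_deriveMr h1 h1)
  (is_deriveMr h2 h2)) (is_deriveMr h3 h3)) _.
by rewrite /imdot; ring.
Qed.

(** The differential of a function of [x = q0 q] and [s = |qim q| ^ 2] whose
    partial derivatives at [q] are [a] in [x] and [a'] in [s].  Only this form
    of the differential is used, so the function of two variables itself need
    not be named. *)
Definition has_axial A (a a' : R[i]) q : Prop := forall w,
  is_cderive q w A ((q0 w)%:C%C * a + (2 * imdot q w)%:C%C * a').

Lemma has_axialD A B (a a' b b' : R[i]) q :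
  has_axial A a a' q -> has_axial B b b' q ->
  has_axial (fun x => A x + B x) (a + b) (a' + b') q.
Proof.
by move=> hA hB w; apply: is_cderive_eq (is_cderiveD (hA w) (hB w)) _; ring.
Qed.

(** The imaginary part stands on the left of the coefficient, as in the slice
    extension; [B] need not commute with it. *)
Definition axial A B q : quat R :=
  slice_emb J (A q) + qim q * slice_emb J (B q).

Lemma is_derive_axial A B (a a' b b' : R[i]) q w :
  has_axial A a a' q -> has_axial B b b' q ->
  is_derive q w (axial A B)
    (q0 w *: (slice_emb J a + qim q * slice_emb J b)
     + (2 * imdot q w) *: (slice_emb J a' + qim q * slice_emb J b')
     + qim w * slice_emb J (B q)).
Proof.
move=> hA hB.
have dA := is_derive_slice_emb J (hA w).
have dB := is_derive_slice_emb J (hB w).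
apply: is_derive_eq (is_deriveDl dA (is_derive_qmul (is_derive_qim q w) dB)) _.
rewrite !slice_embD !slice_embZ.
move: (slice_emb J a) (slice_emb J a') (slice_emb J b) (slice_emb J b')
  (2 * imdot q w) (slice_emb J (B q)) {dA dB hA hB} => P P' Q Q' c S.
rewrite mulrDr -!scalerAr (scalerDr c) (scalerDr (q0 w)).
by rewrite addrA; congr (_ + _); rewrite addrACA.
Qed.

(** Differentiating along [e = i, j, k] produces [2 v_e (A_s + v B_s) + e B].
    Multiplied by [e] on the left and summed, the first term gives
    [2 v A_s + 2 v ^ 2 B_s] with [v ^ 2 = - s], and the second gives [- 3 B]. *)
Lemma dirac_axial A B (a a' b b' : R[i]) q :
  has_axial A a a' q -> has_axial B b b' q ->
  let f := axial A B in
  'D_1 f q + qi R * 'D_(qi R) f q + qj R * 'D_(qj R) f q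
  + qk R * 'D_(qk R) f q =
  slice_emb J (a - 2 * (qsqr (qim q))%:C%C * b' - 3 * B q)
  + qim q * slice_emb J (b + 2 * a').
Proof.
move=> hA hB f.
have d w := @derive_val _ _ _ _ _ _ _ (is_derive_axial w hA hB).
rewrite /f !d.
have nE (n : nat) : n%:R = (n%:R : R)%:C%C by rewrite rmorph_nat.
rewrite !slice_embB !slice_embD -mulrA !nE !slice_embZ qsqr_qim !qimE.
move: (slice_emb J a) (slice_emb J a') (slice_emb J b) (slice_emb J b')
  (slice_emb J (B q)) => {d} P P' Q Q' S.
rewrite quat_oneE /imdot /qone /qi /qj /qk !quat_linE.
move: (q0 q) (q1 q) (q2 q) (q3 q) => x y z t.
have [p0 [p1 [p2 [p3 ->]]]] := quat_mk P.
have [p0' [p1' [p2' [p3' ->]]]] := quat_mk P'.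
have [r0 [r1 [r2 [r3 ->]]]] := quat_mk Q.
have [r0' [r1' [r2' [r3' ->]]]] := quat_mk Q'.
have [s0 [s1 [s2 [s3 ->]]]] := quat_mk S.
by rewrite !mkquatE; congr mkquat; rewrite !quat_linE; ring.
Qed.

(** The Laplacian as a sum over the four directions of one function of the
    direction, so that a formula valid in every direction can be substituted
    at once. *)
Definition frame_sum (F : quat R -> quat R) : quat R :=
  F 1 + F (qi R) + F (qj R) + F (qk R).

Lemma laplacianE (f : quat R -> quat R) q :
  laplacian f q = frame_sum (fun w => 'D_w ('D_w f) q).
Proof. reflexivity. Qed.

Lemma near_laplacian (f g : quat R -> quat R) q :
  (\near q, f q = g q) -> laplacian f q = laplacian g q.
Proof.
move=> /near_join fg; rewrite !laplacianE.
have h w : 'D_w ('D_w f) q = 'D_w ('D_w g) q.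
  by apply: near_eq_derive; apply: filterS fg => x; apply: near_eq_derive.
exact: (congr1 frame_sum (funext h)).
Qed.

(** The second derivative along [e = i, j, k] is
    [4 v_e ^ 2 (A_ss + v B_ss) + 2 (A_s + v B_s) + 4 v_e e B_s]; summing, the
    middle term contributes [6] and the last one [4 v B_s], whence the
    coefficients [6] and [10].  The mixed partial derivatives do not occur,
    because no direction changes both [x] and [s]. *)
Lemma laplacian_axial A A1 A2 B B1 B2
    (a11 a12 a21 a22 b11 b12 b21 b22 : R[i]) q :
  (\near q, has_axial A (A1 q) (A2 q) q) ->
  (\near q, has_axial B (B1 q) (B2 q) q) ->
  has_axial A1 a11 a12 q -> has_axial A2 a21 a22 q ->
  has_axial B1 b11 b12 q -> has_axial B2 b21 b22 q ->
  laplacian (axial A B) q =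
  slice_emb J (a11 + 4 * (qsqr (qim q))%:C%C * a22 + 6 * A2 q)
  + qim q * slice_emb J (b11 + 4 * (qsqr (qim q))%:C%C * b22 + 10 * B2 q).
Proof.
move=> nA nB hA1 hA2 hB1 hB2.
pose g w x := q0 w *: axial A1 B1 x + (2 * imdot x w) *: axial A2 B2 x
   + qim w * slice_emb J (B x).
have d1 w : \near q, g w q = 'D_w (axial A B) q.
  apply: filterS2 nA nB => x hA hB; apply/esym.
  exact: (@derive_val _ _ _ _ _ _ _ (is_derive_axial w hA hB)).
have d2 w : 'D_w ('D_w (axial A B)) q =
  q0 w *: (q0 w *: (slice_emb J a11 + qim q * slice_emb J b11)
     + (2 * imdot q w) *: (slice_emb J a12 + qim q * slice_emb J b12)
     + qim w * slice_emb J (B1 q))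
  + ((2 * imdot q w) *: (q0 w *: (slice_emb J a21 + qim q * slice_emb J b21)
     + (2 * imdot q w) *: (slice_emb J a22 + qim q * slice_emb J b22)
     + qim w * slice_emb J (B2 q))
    + (2 * imdot w w) *: axial A2 B2 q)
  + qim w * (q0 w *: slice_emb J (B1 q) + (2 * imdot q w) *: slice_emb J (B2 q)).
  rewrite -(near_eq_derive w (d1 w)).
  have cst (c : R) : is_derive q w (fun=> c) 0 by apply: is_derive_cst.
  have cstq (c : quat R) : is_derive q w (fun=> c) 0 by apply: is_derive_cst.
  have hB := is_derive_slice_emb J (nbhs_singleton nB w).
  have h := is_deriveDl (is_deriveDl
    (is_deriveZr (cst (q0 w)) (is_derive_axial w hA1 hB1))
    (is_deriveZr (is_deriveMr (cst 2) (is_derive_imdot q w w))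
       (is_derive_axial w hA2 hB2)))
    (is_derive_qmul (cstq (qim w)) hB).
  rewrite (@derive_val _ _ _ _ _ _ _ h).
  rewrite slice_embD !slice_embZ !scale0r !mul0r !mulr0 !addr0.
  by [].
have nE (n : nat) : n%:R = (n%:R : R)%:C%C by rewrite rmorph_nat.
rewrite laplacianE (congr1 frame_sum (funext d2)) /frame_sum.
rewrite !slice_embD -!mulrA !nE !slice_embZ qsqr_qim /axial !qimE.
move: (slice_emb J a11) (slice_emb J a12) (slice_emb J a21) (slice_emb J a22)
  (slice_emb J b11) (slice_emb J b12) (slice_emb J b21) (slice_emb J b22)
  (slice_emb J (A2 q)) (slice_emb J (B1 q)) (slice_emb J (B2 q)).
move=> {d1 d2} a b c d e f g' h x y z.
rewrite quat_oneE /imdot /qone /qi /qj /qk !quat_linE.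
move: (q0 q) (q1 q) (q2 q) (q3 q) => x0 x1 x2 x3.
have [a0 [a1 [a2 [a3 ->]]]] := quat_mk a.
have [b0 [b1 [b2 [b3 ->]]]] := quat_mk b.
have [c0 [c1 [c2 [c3 ->]]]] := quat_mk c.
have [d0 [d1 [d2 [d3 ->]]]] := quat_mk d.
have [e0 [e1 [e2 [e3 ->]]]] := quat_mk e.
have [f0 [f1 [f2 [f3 ->]]]] := quat_mk f.
have [g0 [g1 [g2 [g3 ->]]]] := quat_mk g'.
have [h0 [h1 [h2 [h3 ->]]]] := quat_mk h.
have [x'0 [x'1 [x'2 [x'3 ->]]]] := quat_mk x.
have [y0 [y1 [y2 [y3 ->]]]] := quat_mk y.
have [z0 [z1 [z2 [z3 ->]]]] := quat_mk z.
rewrite !mkquatE; congr mkquat; rewrite !quat_linE.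
- by ring.
- by ring.
- by ring.
- by ring.
Qed.

End AxialCalculus.


(** * Profiles of the kernels and of their Laplacians *)

Section KernelProfiles.
Variables (R : realType) (al be : R[i]).
Implicit Types (q w : quat R) (c : R[i]).

(** The real part of [q] is kept and its imaginary part dropped in
    [al + q be]. *)
Definition kre q : R[i] := al + (q0 q)%:C%C * be.
(** This is [(al + z be) (al + zbar be)] for [z] in the plane of [al] and [be]
    with the real part of [q] and the modulus of its imaginary part; see
    [knorm_factor]. *)
Definition knorm q : R[i] := kre q ^+ 2 + (qsqr (qim q))%:C%C * be ^+ 2.
Definition mono c m n q : R[i] := c * kre q ^+ m * (knorm q)^-1 ^+ n.

(** The partial derivatives of a monomial in [u] and [1 / N], from
    [u_x = be], [u_s = 0], [N_x = 2 u be] and [N_s = be ^ 2].  For [m = 0] the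
    truncated predecessor is harmless since the coefficient vanishes. *)
Definition mono_x c m n q : R[i] :=
  mono (c * m%:R * be) m.-1 n q + mono (- (2 * c * n%:R * be)) m.+1 n.+1 q.
Definition mono_s c m n q : R[i] := mono (- (c * n%:R * be ^+ 2)) m n.+1 q.

Lemma has_axial_mono c m n q : knorm q != 0 ->
  has_axial (mono c m n) (mono_x c m n q) (mono_s c m n q) q.
Proof.
move=> n0 w.
have cst (a : R[i]) : is_cderive q w (fun=> a) 0 by apply: is_cderive_cst.
have du : is_cderive q w kre ((q0 w)%:C%C * be).
  apply: is_cderive_eq (is_cderiveD (cst al)
    (is_cderiveM (is_cderiveR (is_derive_q0 q w)) (cst be))) _.
  by ring.
have dn := is_cderiveD (is_cderiveX 2 du)
  (is_cderiveM (is_cderiveR (is_derive_qsqr_qim q w)) (cst (be ^+ 2))).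
have dM := is_cderiveX n (is_cderiveV n0 dn).
apply: is_cderive_eq (is_cderiveM (is_cderiveM (cst c) (is_cderiveX m du)) dM) _.
rewrite /mono_x /mono_s /mono /=.
move: (knorm q)^-1 (2 * imdot q w)%:C%C (q0 w)%:C%C (qsqr (qim q))%:C%C (kre q)
  => M d x s u.
case: m => [|m]; case: n {dM} => [|n] /=; rewrite ?exprS ?expr0; ring.
Qed.

(** Profiles of the kernel: with [p = al + z be] and [m = al + zbar be], one
    has [N = p m] and [u = (p + m) / 2], so that [kA] is the mean of
    [p ^- 2] and [m ^- 2]. *)
Definition kA q := mono 2 2 2 q + mono (-1) 0 1 q.
Definition kA_x q := mono_x 2 2 2 q + mono_x (-1) 0 1 q.
Definition kA_s q := mono_s 2 2 2 q + mono_s (-1) 0 1 q.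
Definition kB q := mono (- (2 * be)) 1 2 q.
Definition kB_x q := mono_x (- (2 * be)) 1 2 q.
Definition kB_s q := mono_s (- (2 * be)) 1 2 q.
(** Profiles of the Laplacian of the kernel, obtained from
    [A_xx + 4 s A_ss + 6 A_s] and [B_xx + 4 s B_ss + 10 B_s] by eliminating
    [s be ^ 2 = N - u ^ 2]. *)
Definition lapA q := mono (4 * be ^+ 2) 0 2 q + mono (- (16 * be ^+ 2)) 2 3 q.
Definition lapB q := mono (16 * be ^+ 3) 1 3 q.

Lemma has_axial_kA q : knorm q != 0 -> has_axial kA (kA_x q) (kA_s q) q.
Proof. by move=> n0; apply: has_axialD; apply: has_axial_mono. Qed.

Lemma has_axial_kB q : knorm q != 0 -> has_axial kB (kB_x q) (kB_s q) q.
Proof. exact: has_axial_mono. Qed.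

Lemma has_axial_kA_second q : knorm q != 0 -> exists a11 a12 a21 a22,
  [/\ has_axial kA_x a11 a12 q, has_axial kA_s a21 a22 q &
      a11 + 4 * (qsqr (qim q))%:C%C * a22 + 6 * kA_s q = lapA q].
Proof.
move=> n0; do 4!eexists; split.
- by apply: has_axialD; apply: has_axialD; apply: has_axial_mono.
- by apply: has_axialD; apply: has_axial_mono.
- move: n0; rewrite /kA_s /lapA /mono_x /mono_s /mono /knorm /=.
  move: (kre q) (qsqr (qim q))%:C%C => u s n0.
  by field.
Qed.

Lemma has_axial_kB_second q : knorm q != 0 -> exists b11 b12 b21 b22,
  [/\ has_axial kB_x b11 b12 q, has_axial kB_s b21 b22 q &
      b11 + 4 * (qsqr (qim q))%:C%C * b22 + 10 * kB_s q = lapB q].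
Proof.
move=> n0; do 4!eexists; split.
- by apply: has_axialD; apply: has_axial_mono.
- by apply: has_axial_mono.
- move: n0; rewrite /kB_s /lapB /mono_x /mono_s /mono /knorm /=.
  move: (kre q) (qsqr (qim q))%:C%C => u s n0.
  by field.
Qed.

(** The two conditions say that [lapA + v lapB] is in the kernel of the Dirac
    operator, in the form given by [dirac_axial]. *)
Lemma has_axial_lap q : knorm q != 0 -> exists a a' b b',
  [/\ has_axial lapA a a' q, has_axial lapB b b' q,
      a - 2 * (qsqr (qim q))%:C%C * b' - 3 * lapB q = 0 & b + 2 * a' = 0].
Proof.
move=> n0; do 4!eexists; split.
- by apply: has_axialD; apply: has_axial_mono.
- by apply: has_axial_mono.
- move: n0; rewrite /lapB /mono_x /mono_s /mono /knorm /=.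
  move: (kre q) (qsqr (qim q))%:C%C => u s n0.
  by field.
- rewrite /mono_x /mono_s /mono /=; ring.
Qed.

End KernelProfiles.

(** * The slice extension of an inverse square *)

Section KernelExtension.
Variables (R : realType) (J : quat R).
Implicit Types (al be z : R[i]) (q : quat R).

(** Both halves of the extension are computed in terms of [p = u + i y be] and
    [m = u - i y be], where [y = |qim q|].  The factor [y] produced by the
    second half is what turns the unit [iunit q] into [qim q], which makes the
    formula smooth across the real axis. *)
Lemma qext_kernel al be q : imsphere J -> knorm al be q != 0 ->
  qext J (fun p => (slice_emb J al + p * slice_emb J be) ^- 2) q =
  axial J (kA al be) (kB al be) q.
Proof.
move=> SJ n0; rewrite /qext.
set y := qabs (qim q).
have y2 : qsqr (qim q) = y ^+ 2.
  by rewrite /y /qabs sqr_sqrtr // /qsqr !addr_ge0 ?sqr_ge0.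
have yI : y *: iunit q = qim q.
  rewrite /iunit /y; case: eqP => [e|/eqP e].
    by rewrite e /qabs (eqP _ : qsqr 0 = 0) ?qsqr_eq0 // sqrtr0 scale0r.
  rewrite scalerA divff ?scale1r // /qabs sqrtr_eq0 -ltNge lt_def qsqr_eq0 e.
  by rewrite /qsqr !addr_ge0 ?sqr_ge0.
pose z := (q0 q)%:C%C + 'i%C * y%:C%C; pose z' := (q0 q)%:C%C - 'i%C * y%:C%C.
have zE : (q0 q)%:A + y *: J = slice_emb J z.
  by rewrite /z slice_embD slice_embR mulrC slice_embZ slice_emb_unit.
have z'E : (q0 q)%:A - y *: J = slice_emb J z'.
  by rewrite /z' slice_embB slice_embR mulrC slice_embZ slice_emb_unit.
have gE w : (slice_emb J al + slice_emb J w * slice_emb J be) ^- 2 =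
    slice_emb J ((al + w * be) ^- 2).
  by rewrite -slice_embM // -slice_embD -slice_embX // -slice_embV.
rewrite zE z'E !gE.
set g := (al + z * be) ^- 2; set g' := (al + z' * be) ^- 2.
have halfE c : 2^-1 *: slice_emb J c = slice_emb J (2^-1 * c).
  by rewrite -slice_embZ fmorphV rmorph_nat.
have JE c : J * slice_emb J c = slice_emb J ('i%C * c).
  by rewrite slice_embM // slice_emb_unit.
rewrite -slice_embD -slice_embB -mulrA JE scalerAr !halfE.
rewrite /axial -[in RHS]yI -scalerAl scalerAr -slice_embZ.
pose p := kre al be q + 'i%C * y%:C%C * be.
pose m := kre al be q - 'i%C * y%:C%C * be.
have i2 : 'i%C ^+ 2 = -1 :> R[i] by rewrite sqr_i.
have nE' : knorm al be q = p * m.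
  by rewrite /knorm y2 rmorphXn /= /p /m; ring: i2.
have [p0 m0] : p != 0 /\ m != 0.
  by move: n0; rewrite nE' mulf_eq0 negb_or => /andP.
have zp : al + z * be = p by rewrite /z /p /kre; ring.
have zm : al + z' * be = m by rewrite /z' /m /kre; ring.
rewrite /g /g' zp zm; congr (_ + iunit q * _); congr slice_emb.
- rewrite /kA /mono nE'.
  have -> : kre al be q = (p + m) / 2 by rewrite /p /m; field.
  by field; rewrite p0 m0.
- rewrite /kB /mono nE'.
  (* p - m = 2 i y be, so that i (p - m) = - 2 y be *)
  have -> : y%:C%C * (- (2 * be) * kre al be q ^+ 1 * (p * m)^-1 ^+ 2) =
     ('i%C * (p - m)) * ((p + m) / 2) * (p * m)^-1 ^+ 2.
    by move: (p * m)^-1 => M; rewrite /p /m; field: i2.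
  by field; rewrite p0 m0.
Qed.

End KernelExtension.


(** * Laplacian and Dirac derivative of the kernels *)

Section KernelLaplacian.
Variables (R : realType) (J : quat R).
Implicit Types (al be z : R[i]) (q : quat R).

Lemma axialD (A B A' B' : quat R -> R[i]) q :
  axial J A B q + axial J A' B' q =
  axial J (fun x => A x + A' x) (fun x => B x + B' x) q.
Proof. by rewrite {3}/axial !slice_embD mulrDr; exact: addrACA. Qed.

Lemma laplacian_kernel al be q : (\near q, knorm al be q != 0) ->
  laplacian (axial J (kA al be) (kB al be)) q =
  axial J (lapA al be) (lapB al be) q.
Proof.
move=> nn; have n0 := nbhs_singleton nn.
have [a11 [a12 [a21 [a22 [hA1 hA2 eA]]]]] := has_axial_kA_second n0.
have [b11 [b12 [b21 [b22 [hB1 hB2 eB]]]]] := has_axial_kB_second n0.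
rewrite (laplacian_axial J _ _ hA1 hA2 hB1 hB2) ?eA ?eB //.
- by apply: filterS nn => x; apply: has_axial_kA.
- by apply: filterS nn => x; apply: has_axial_kB.
Qed.

Lemma laplacian_kernelD al be al' be' q :
  (\near q, knorm al be q != 0) -> (\near q, knorm al' be' q != 0) ->
  laplacian (axial J (fun x => kA al be x + kA al' be' x)
                     (fun x => kB al be x + kB al' be' x)) q =
  axial J (lapA al be) (lapB al be) q + axial J (lapA al' be') (lapB al' be') q.
Proof.
move=> nn nn'; have n0 := nbhs_singleton nn; have n0' := nbhs_singleton nn'.
have [a11 [a12 [a21 [a22 [hA1 hA2 eA]]]]] := has_axial_kA_second n0.
have [b11 [b12 [b21 [b22 [hB1 hB2 eB]]]]] := has_axial_kB_second n0.
have [c11 [c12 [c21 [c22 [hC1 hC2 eC]]]]] := has_axial_kA_second n0'.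
have [d11 [d12 [d21 [d22 [hD1 hD2 eD]]]]] := has_axial_kB_second n0'.
rewrite (laplacian_axial J _ _ (has_axialD hA1 hC1) (has_axialD hA2 hC2)
  (has_axialD hB1 hD1) (has_axialD hB2 hD2)); last first.
- by apply: filterS2 nn nn' => x hx hx'; apply: has_axialD; apply: has_axial_kB.
- by apply: filterS2 nn nn' => x hx hx'; apply: has_axialD; apply: has_axial_kA.
rewrite axialD /axial -eA -eB -eC -eD.
by congr (slice_emb J _ + _ * slice_emb J _); ring.
Qed.

Lemma dirac_kernelD al be al' be' q :
  knorm al be q != 0 -> knorm al' be' q != 0 ->
  let f := fun x => axial J (lapA al be) (lapB al be) x
                  + axial J (lapA al' be') (lapB al' be') x in
  'D_1 f q + qi R * 'D_(qi R) f q + qj R * 'D_(qj R) f q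
  + qk R * 'D_(qk R) f q = 0.
Proof.
move=> n0 n0' f.
have -> : f = axial J (fun x => lapA al be x + lapA al' be' x)
                      (fun x => lapB al be x + lapB al' be' x).
  by apply/funext => x; rewrite /f axialD.
have [a [a' [b [b' [hA hB e1 e2]]]]] := has_axial_lap n0.
have [c [c' [d [d' [hC hD e3 e4]]]]] := has_axial_lap n0'.
rewrite (dirac_axial J (has_axialD hA hC) (has_axialD hB hD)).
set X := (X in slice_emb J X + _); set Y := (Y in _ * slice_emb J Y).
have -> : X = (a - 2 * (qsqr (qim q))%:C%C * b' - 3 * lapB al be q)
    + (c - 2 * (qsqr (qim q))%:C%C * d' - 3 * lapB al' be' q) by rewrite /X; ring.
have -> : Y = (b + 2 * a') + (d + 2 * c') by rewrite /Y; ring.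
rewrite e1 e2 e3 e4 addr0 -[0 : R[i]]/(0%:C)%C slice_embR scale0r mulr0 addr0.
by [].
Qed.

End KernelLaplacian.

(** * The Bergman-Fueter kernel as a rational function of quaternions *)

Section ClosedForm.
Variable R : realType.
Implicit Types (a b q : quat R) (al be : R[i]).

Definition qre a b q : quat R := a + q0 q *: b.
Definition qnorm a b q : quat R := qre a b q ^+ 2 + qsqr (qim q) *: b ^+ 2.
(** The Laplacian of the kernel with quaternions in place of the complex
    parameters.  The formula no longer refers to a plane, hence it can be
    differentiated in all its arguments and read in every plane containing [a]
    and [b]. *)
Definition bf_kernel a b q : quat R :=
  4 *: (b ^+ 2 * (qnorm a b q)^-1 ^+ 2)
  - 16 *: (b ^+ 2 * qre a b q ^+ 2 * (qnorm a b q)^-1 ^+ 3)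
  + qim q * (16 *: (b ^+ 3 * qre a b q * (qnorm a b q)^-1 ^+ 3)).

Lemma qnorm_slice J al be q : imsphere J ->
  qnorm (slice_emb J al) (slice_emb J be) q = slice_emb J (knorm al be q).
Proof.
move=> SJ; rewrite /qnorm /qre /knorm /kre slice_embD slice_embX // slice_embD.
by rewrite !slice_embZ slice_embX.
Qed.

Lemma axial_bf_kernel J al be q : imsphere J ->
  axial J (lapA al be) (lapB al be) q =
  bf_kernel (slice_emb J al) (slice_emb J be) q.
Proof.
move=> SJ; rewrite /bf_kernel qnorm_slice //.
have -> : qre (slice_emb J al) (slice_emb J be) q = slice_emb J (kre al be q).
  by rewrite /qre /kre slice_embD slice_embZ.
rewrite /axial /lapA /lapB /mono -slice_embV //.
move: (kre al be q) (knorm al be q)^-1 => u M.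
have nE (n : nat) c : n%:R *: slice_emb J c = slice_emb J (n%:R * c).
  by rewrite -slice_embZ rmorph_nat.
rewrite -!slice_embX // -!slice_embM // !nE -slice_embB.
by congr (slice_emb J _ + _ * slice_emb J _); ring.
Qed.

Lemma differentiable_qX (V : normedModType R) (f : V -> quat R) n p :
  differentiable f p -> differentiable (fun x => f x ^+ n) p.
Proof.
move=> df; elim: n => [|n IH].
  by under eq_fun do rewrite expr0; apply: differentiable_cst.
by under eq_fun do rewrite exprS; apply: differentiable_qmul.
Qed.

Lemma differentiable_qscale (V : normedModType R) (k : V -> R)
    (f : V -> quat R) p :
  differentiable k p -> differentiable f p ->
  differentiable (fun x => k x *: f x) p.
Proof.
move=> dk df.
have E x : k x *: f x = (k x *: (1 : quat R)) * f x by rewrite -scalerAl mul1r.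
rewrite (funext E).
exact: (differentiable_qmul (differentiableZl _ dk) df).
Qed.

Lemma differentiable_bf_kernel (V : normedModType R) (a b q : V -> quat R) p :
  differentiable a p -> differentiable b p -> differentiable q p ->
  qnorm (a p) (b p) (q p) != 0 ->
  differentiable (fun x => bf_kernel (a x) (b x) (q x)) p.
Proof.
move=> da db dq n0.
have [dq0 _ _ _] := differentiable_coords dq.
have dim : differentiable (fun x => qim (q x)) p.
  exact: (differentiableB dq (differentiableZl _ dq0)).
have du : differentiable (fun x => qre (a x) (b x) (q x)) p.
  exact: (differentiableD da (differentiable_qscale dq0 db)).
have dn : differentiable (fun x => qnorm (a x) (b x) (q x)) p.
  exact: (differentiableD (differentiable_qX 2 du)
    (differentiable_qscale (differentiable_qsqr dim) (differentiable_qX 2 db))).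
have dM := differentiable_qinv dn n0.
have cst (c : R) : differentiable (fun _ : V => c) p by apply: differentiable_cst.
exact: (differentiableD (differentiableB
  (differentiable_qscale (cst 4)
    (differentiable_qmul (differentiable_qX 2 db) (differentiable_qX 2 dM)))
  (differentiable_qscale (cst 16)
    (differentiable_qmul (differentiable_qmul (differentiable_qX 2 db)
      (differentiable_qX 2 du)) (differentiable_qX 3 dM))))
  (differentiable_qmul dim (differentiable_qscale (cst 16)
    (differentiable_qmul (differentiable_qmul (differentiable_qX 3 db) du)
      (differentiable_qX 3 dM))))).
Qed.

End ClosedForm.


(** * The half-ball and the zeros of the denominators *)

Section HalfBall.
Variable R : realType.
Implicit Types (q r : quat R) (z : R[i]).

Lemma differentiable_quat_id q : differentiable (fun x : quat R => x) q.
Proof. by have [] := is_diff_id q. Qed.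

Lemma halfball4E q : halfball4 q <-> qsqr q < 1 /\ 0 < q0 q.
Proof.
rewrite /halfball4 /ball4 /halfspace4 /= /setI /=.
have s0 : 0 <= qsqr q by rewrite /qsqr !addr_ge0 ?sqr_ge0.
by rewrite /qabs -[X in _ < X]sqrtr1 ltr_sqrt.
Qed.

Lemma near_halfball4 q : halfball4 q -> \near q, halfball4 q.
Proof.
move=> /halfball4E[h1 h2].
have [c0 _ _ _] := differentiable_coords (differentiable_quat_id q).
have cs := differentiable_qsqr (differentiable_quat_id q).
have n1 := cvgr_lt _ (differentiable_continuous cs) _ h1.
have n2 := cvgr_gt _ (differentiable_continuous c0) _ h2.
have F : Filter (nbhs q) by exact: nbhs_filter.
by apply: filterS2 (n1 F) (n2 F) => x ? ?; apply/halfball4E.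
Qed.

Lemma imsphere_iunit q : imsphere (iunit q).
Proof.
rewrite /iunit; case: eqP => [_|/eqP e]; apply/imsphereP.
  by rewrite /qi /qsqr !quat_linE; split => //; ring.
have s0 : 0 <= qsqr (qim q) by rewrite /qsqr !addr_ge0 ?sqr_ge0.
split; first by rewrite qimE !quat_linE mulr0.
by rewrite qsqrZ exprVn /qabs sqr_sqrtr // mulVf // qsqr_eq0.
Qed.

(** For real [q] the unit [iunit q] is arbitrary, but its coefficient is
    zero. *)
Lemma slice_coord q :
  q = slice_emb (iunit q) (Complex (q0 q) (qabs (qim q))).
Proof.
rewrite /slice_emb /= /iunit; case: eqP => [e|/eqP e].
  rewrite e /qabs (eqP (_ : qsqr 0 == 0)) ?qsqr_eq0 // sqrtr0 scale0r addr0.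
  by apply/eqP; rewrite -subr_eq0 -/(qim q) e.
rewrite scalerA divff ?scale1r; first by rewrite /qim addrC subrK.
rewrite /qabs sqrtr_eq0 -ltNge lt_def qsqr_eq0 e.
by rewrite /qsqr !addr_ge0 ?sqr_ge0.
Qed.

Lemma halfball4_slice J z : imsphere J ->
  halfball4 (slice_emb J z) <->
  complex.Re z ^+ 2 + complex.Im z ^+ 2 < 1 /\ 0 < complex.Re z.
Proof.
move=> /imsphereP[J0 J1].
have e0 : q0 (slice_emb J z) = complex.Re z.
  by rewrite /slice_emb quat_oneE /qone !quat_linE J0; ring.
have es : qsqr (slice_emb J z) = complex.Re z ^+ 2 + complex.Im z ^+ 2.
  have E : q1 J ^+ 2 + q2 J ^+ 2 + q3 J ^+ 2 = 1.
    by move: J1; rewrite /qsqr J0 expr0n /= add0r.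
  rewrite -[complex.Im z ^+ 2]mulr1 -E.
  by rewrite /qsqr /slice_emb quat_oneE /qone !quat_linE J0; ring.
by split; rewrite halfball4E e0 es.
Qed.

Lemma knorm_factor (al be : R[i]) q :
  knorm al be q = (al + (Complex (q0 q) (qabs (qim q))) * be)
             * (al + (Complex (q0 q) (- qabs (qim q))) * be).
Proof.
have y2 : qsqr (qim q) = qabs (qim q) ^+ 2.
  by rewrite /qabs sqr_sqrtr // /qsqr !addr_ge0 ?sqr_ge0.
have i2 : 'i%C ^+ 2 = -1 :> R[i] by rewrite sqr_i.
rewrite /knorm /kre y2 rmorphXn /=; move: (q0 q) (qabs (qim q)) => x y.
rewrite [Complex x y]complexE [Complex x (- y)]complexE /= rmorphN /=.
by ring: i2.
Qed.

(** A zero of [N] would give [w z = 1] with [|w| < 1] and [|z| < 1]. *)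
Lemma halfball4_knorm_disk J z q : imsphere J -> halfball4 q ->
  halfball4 (slice_emb J z) -> knorm 1 (- z) q != 0.
Proof.
move=> SJ hq /(halfball4_slice _ SJ)[hz _].
have := hq; rewrite {1}[q]slice_coord => /(halfball4_slice _ (imsphere_iunit _)).
move=> [/= hw _].
have key (w : R[i]) : complex.Re w ^+ 2 + complex.Im w ^+ 2 < 1 -> 1 + w * - z != 0.
  move=> hw1; rewrite mulrN subr_eq0; apply/eqP => e.
  case: w z hw1 hz e => a b [c d] /= hw1 hz [e1 e2].
  have E : (a ^+ 2 + b ^+ 2) * (c ^+ 2 + d ^+ 2) = 1.
    have -> : (a ^+ 2 + b ^+ 2) * (c ^+ 2 + d ^+ 2)
      = (a * c - b * d) ^+ 2 + (a * d + b * c) ^+ 2 by ring.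
    by rewrite -e1 -e2; ring.
  have n0 (s t : R) : 0 <= s ^+ 2 + t ^+ 2 by rewrite addr_ge0 ?sqr_ge0.
  by have := mulr_ilt1 (n0 a b) (n0 c d) hw1 hz; rewrite E ltxx.
by rewrite knorm_factor mulf_neq0 // key //= sqrrN.
Qed.

(** A zero of [N] would give a sum of two numbers of positive real part equal
    to zero. *)
Lemma halfball4_knorm_halfplane J z q : imsphere J -> halfball4 q ->
  halfball4 (slice_emb J z) -> knorm z 1 q != 0.
Proof.
move=> SJ /halfball4E[_ hq] /(halfball4_slice _ SJ)[_ hz].
have key (y : R) : z + Complex (q0 q) y * 1 != 0.
  rewrite mulr1; case: z hz => a b /= hz; apply/eqP => -[e _].
  by move: hz; rewrite -[a](addrK (q0 q)) e; lra.
by rewrite knorm_factor mulf_neq0.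
Qed.

End HalfBall.

(** * Dependence on the second variable in one plane *)

Section Holomorphy.
Variable R : realType.
Implicit Types (a b : R[i] -> R[i]) (z : R[i]).

(** Complex differentiability of [a] at [z], stated as the chain rule along all
    real curves through [z]; only the derivatives along the two coordinate
    lines are needed for the Cauchy-Riemann equation, and in this form the
    rules of [is_cderive] give the rules for [holo]. *)
Definition holo a z : Prop := exists d : R[i], forall (c : R -> R[i]) t dc,
  c t = z -> is_cderive t 1 c dc -> is_cderive t 1 (fun s => a (c s)) (d * dc).

Lemma holo_cst (k : R[i]) z : holo (fun=> k) z.
Proof. by exists 0 => c t dc _ _; rewrite mul0r; apply: is_cderive_cst. Qed.

Lemma holo_id z : holo id z.
Proof. by exists 1 => c t dc _ h; rewrite mul1r. Qed.

Lemma holoD a b z : holo a z -> holo b z -> holo (fun x => a x + b x) z.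
Proof.
move=> [d hd] [e he]; exists (d + e) => c t dc cz hc; rewrite mulrDl.
by apply: is_cderiveD; [exact: hd|exact: he].
Qed.

Lemma holoN a z : holo a z -> holo (fun x => - a x) z.
Proof.
move=> [d hd]; exists (- d) => c t dc cz hc; rewrite mulNr.
by apply: is_cderiveN; exact: hd.
Qed.

Lemma holoM a b z : holo a z -> holo b z -> holo (fun x => a x * b x) z.
Proof.
move=> [d hd] [e he]; exists (a z * e + d * b z) => c t dc cz hc.
apply: is_cderive_eq (is_cderiveM (hd _ _ _ cz hc) (he _ _ _ cz hc)) _.
by rewrite cz; ring.
Qed.

Lemma holoX a n z : holo a z -> holo (fun x => a x ^+ n) z.
Proof.
move=> ha; elim: n => [|n IH].
  by under eq_fun do rewrite expr0; apply: holo_cst.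
by under eq_fun do rewrite exprS; apply: holoM.
Qed.

Lemma holoV a z : a z != 0 -> holo a z -> holo (fun x => (a x)^-1) z.
Proof.
move=> a0 [d hd]; exists (- ((a z)^-1 ^+ 2 * d)) => c t dc cz hc.
have h0 : a (c t) != 0 by rewrite cz.
apply: is_cderive_eq (is_cderiveV h0 (hd _ _ _ cz hc)) _.
by rewrite cz; ring.
Qed.

Lemma holo_mono (al be k : R[i] -> R[i]) m n q z :
  holo al z -> holo be z -> holo k z -> knorm (al z) (be z) q != 0 ->
  holo (fun x => mono (al x) (be x) (k x) m n q) z.
Proof.
move=> hal hbe hk n0.
have hu : holo (fun x => kre (al x) (be x) q) z.
  exact: (holoD hal (holoM (holo_cst _ _) hbe)).
have hn : holo (fun x => knorm (al x) (be x) q) z.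
  exact: (holoD (holoX 2 hu) (holoM (holo_cst _ _) (holoX 2 hbe))).
have hM : holo (fun x => (knorm (al x) (be x) q)^-1) z.
  exact (@holoV (fun x => knorm (al x) (be x) q) z n0 hn).
exact: (holoM (holoM hk (holoX m hu)) (holoX n hM)).
Qed.

Lemma holo_lapA al be q z : holo al z -> holo be z ->
  knorm (al z) (be z) q != 0 -> holo (fun x => lapA (al x) (be x) q) z.
Proof.
move=> hal hbe n0.
have h2 := holoX 2 hbe.
apply: holoD; apply: holo_mono => //.
- exact: (holoM (holo_cst _ _) h2).
- exact: (holoN (holoM (holo_cst _ _) h2)).
Qed.

Lemma holo_lapB al be q z : holo al z -> holo be z ->
  knorm (al z) (be z) q != 0 -> holo (fun x => lapB (al x) (be x) q) z.
Proof.
move=> hal hbe n0; apply: holo_mono => //.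
exact: (holoM (holo_cst _ _) (holoX 3 hbe)).
Qed.

(** The profiles are rational with real coefficients in [al] and [be], hence
    commute with conjugation. *)
Lemma conj_mono (al be k : R[i]) m n q :
  ((mono al be k m n q)^*)%C = mono (al^*)%C (be^*)%C (k^*)%C m n q.
Proof.
rewrite /mono /knorm /kre !(rmorphM, rmorphXn, fmorphV, rmorphD) /=.
by rewrite !oppr0.
Qed.

Let conj_natX (be : R[i]) n k :
  ((n%:R * be ^+ k)^*)%C = n%:R * ((be^*)%C) ^+ k.
Proof. by rewrite rmorphM rmorphXn /= conjc_nat. Qed.

Lemma conj_lapA (al be : R[i]) q :
  ((lapA al be q)^*)%C = lapA (al^*)%C (be^*)%C q.
Proof.
by rewrite /lapA rmorphD /= !conj_mono rmorphN /= !conj_natX.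
Qed.

Lemma conj_lapB (al be : R[i]) q :
  ((lapB al be q)^*)%C = lapB (al^*)%C (be^*)%C q.
Proof. by rewrite /lapB conj_mono conj_natX. Qed.

(** Both partial derivatives are the complex derivative up to the factors [1]
    and [i], and [I] times the image of [i c] is minus the image of [c].  The
    constant [Q] on the right is out of reach of the operator, which acts on
    the left. *)
Lemma cauchy_riemann_slice (I Q : quat R) a b (x y : R) : imsphere I ->
  holo a (Complex x y) -> holo b (Complex x y) ->
  let f z := slice_emb I (a z) + slice_emb I (b z) * Q in
  (fun t : R => f (Complex t y))^`()%classic x
  + I * (fun t : R => f (Complex x t))^`()%classic y = 0.
Proof.
move=> SI [a' ha] [b' hb] f; rewrite !derive1E.
have cx : is_cderive x 1 (fun t => Complex t y) 1.
  by split; [exact: is_derive_id|exact: is_derive_cst].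
have cy : is_cderive y 1 (fun t => Complex x t) 'i%C.
  by split; [exact: is_derive_cst|exact: is_derive_id].
have D (c : R -> R[i]) t dc : c t = Complex x y -> is_cderive t 1 c dc ->
    'D_1 (fun s => f (c s)) t
    = slice_emb I (a' * dc) + slice_emb I (b' * dc) * Q.
  move=> ct hc.
  have dQ : is_derive t 1 (fun=> Q) 0 by apply: is_derive_cst.
  have hh := is_deriveDl (is_derive_slice_emb I (ha _ _ _ ct hc))
    (is_derive_qmul (is_derive_slice_emb I (hb _ _ _ ct hc)) dQ).
  by rewrite (@derive_val _ _ _ _ _ _ _ hh) mulr0 add0r.
rewrite (D (fun t => Complex t y) x 1 erefl cx).
rewrite (D (fun t => Complex x t) y _ erefl cy).
have IE (c : R[i]) : I * slice_emb I (c * 'i%C) = - slice_emb I (c * 1).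
  rewrite -{1}(slice_emb_unit I) -slice_embM // -slice_embN; congr slice_emb.
  by rewrite mulrCA -expr2 sqr_i; ring.
by rewrite mulrDr mulrA !IE mulNr addrACA !subrr addr0.
Qed.

End Holomorphy.


(** * The Bergman-Fueter kernel of the half-ball *)

Section BergmanFueter.
Variable R : realType.
Implicit Types (q r : quat R) (z : R[i]).

Lemma slice_emb_neq0 (J : quat R) z : imsphere J -> z != 0 -> slice_emb J z != 0.
Proof.
move=> SJ z0; apply/eqP => e.
have : slice_emb J z * slice_emb J z^-1 = 1.
  by rewrite -slice_embM // divff // slice_emb1.
by rewrite e mul0r => /eqP; rewrite eq_sym oner_eq0.
Qed.

Lemma halfball4_conj (J : quat R) z : imsphere J ->
  halfball4 (slice_emb J z) -> halfball4 (slice_emb J (z^*)%C).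
Proof.
by move=> SJ /(halfball4_slice _ SJ); rewrite halfball4_slice //;
  case: z => a b /=; rewrite sqrrN.
Qed.

Lemma qextD (J : quat R) (g h : quat R -> quat R) q :
  qext J (fun p => g p + h p) q = qext J g q + qext J h q.
Proof.
rewrite /qext.
move: ((q0 q)%:A + qabs (qim q) *: J) ((q0 q)%:A - qabs (qim q) *: J) => z z'.
move: (g z) (g z') (h z) (h z') (iunit q * J) => a a' b b' I.
have -> : a + b + (a' + b') = (a + a') + (b + b') by exact: addrACA.
have -> : a' + b' - (a + b) = (a' - a) + (b' - b) by rewrite opprD; exact: addrACA.
rewrite mulrDr !(scalerDr (2^-1)); exact: addrACA.
Qed.

Lemma K_halfballE q r : K_halfball q r = K_ball q r + K_halfspace q r.
Proof. by rewrite /K_ball /K_halfspace /slice_kernel -qextD. Qed.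

(** The parameter of the kernels is the conjugate of [r], which stays in the
    half-ball. *)
Lemma halfball4_qconj r : halfball4 r -> exists z,
  qconj r = slice_emb (iunit r) z /\ halfball4 (slice_emb (iunit r) z).
Proof.
move=> hr; exists ((Complex (q0 r) (qabs (qim r)))^*)%C.
have SJ := imsphere_iunit r; split.
  by rewrite slice_emb_conj // -slice_coord.
by apply: halfball4_conj => //; rewrite -slice_coord.
Qed.

(** The kernels agree with axial functions on a whole neighbourhood of [q], so
    their Laplacians at [q] agree; reading the result in quaternions removes
    the plane of [r] from it. *)
Lemma bergman_fueter_closed q r : halfball4 q -> halfball4 r ->
  [/\ KBF_ball q r = bf_kernel 1 (- qconj r) q,
      KBF_halfspace q r = bf_kernel (qconj r) 1 q &
      KBF_halfball q r = bf_kernel 1 (- qconj r) q + bf_kernel (qconj r) 1 q].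
Proof.
move=> hq hr; set J := iunit r; have SJ : imsphere J by exact: imsphere_iunit.
have [z [rE hz]] := halfball4_qconj hr; rewrite -/J in rE hz.
have n1 : \near q, knorm 1 (- z) q != 0.
  by apply: filterS (near_halfball4 hq) => x hx; exact: halfball4_knorm_disk SJ hx hz.
have n2 : \near q, knorm z 1 q != 0.
  apply: filterS (near_halfball4 hq) => x hx.
  exact: halfball4_knorm_halfplane SJ hx hz.
have k1 : \near q, K_ball q r = axial J (kA 1 (- z)) (kB 1 (- z)) q.
  have gE p : bergman_disk p r =
      (slice_emb J 1 + p * slice_emb J (- z)) ^- 2.
    by rewrite slice_emb1 slice_embN mulrN -rE.
  apply: filterS n1 => x hx.
  exact: etrans (congr1 (fun g => qext J g x) (funext gE)) (qext_kernel SJ hx).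
have k2 : \near q, K_halfspace q r = axial J (kA z 1) (kB z 1) q.
  have gE p : bergman_halfplane p r =
      (slice_emb J z + p * slice_emb J 1) ^- 2.
    by rewrite slice_emb1 mulr1 -rE /bergman_halfplane addrC.
  apply: filterS n2 => x hx.
  exact: etrans (congr1 (fun g => qext J g x) (funext gE)) (qext_kernel SJ hx).
have k3 : \near q, K_halfball q r =
    axial J (fun x => kA 1 (- z) x + kA z 1 x)
            (fun x => kB 1 (- z) x + kB z 1 x) q.
  by apply: filterS2 k1 k2 => x e1 e2; rewrite K_halfballE e1 e2 axialD.
have a1 := axial_bf_kernel 1 (- z) q SJ; rewrite slice_emb1 slice_embN -rE in a1.
have a2 := axial_bf_kernel z 1 q SJ; rewrite slice_emb1 -rE in a2.
split.
- by rewrite /KBF_ball (near_laplacian k1) laplacian_kernel.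
- by rewrite /KBF_halfspace (near_laplacian k2) laplacian_kernel.
- by rewrite /KBF_halfball (near_laplacian k3) laplacian_kernelD // a1 a2.
Qed.

Lemma qnorm_neq0 q r : halfball4 q -> halfball4 r ->
  qnorm 1 (- qconj r) q != 0 /\ qnorm (qconj r) 1 q != 0.
Proof.
move=> hq hr; have SJ := imsphere_iunit r.
have [z [-> hz]] := halfball4_qconj hr.
rewrite -slice_embN -(slice_emb1 (iunit r)) !qnorm_slice //.
split; apply: slice_emb_neq0 => //.
- exact: halfball4_knorm_disk SJ hq hz.
- exact: halfball4_knorm_halfplane SJ hq hz.
Qed.

Lemma qconjD q r : qconj (q + r) = qconj q + qconj r.
Proof. by apply: quatP; rewrite /qconj !quat_linE // opprD. Qed.

Lemma qconjM q r : qconj (q * r) = qconj r * qconj q.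
Proof.
by apply: quatP; rewrite !quat_mulE /qmul /qconj !quat_linE; ring.
Qed.

Lemma qconjK : involutive (@qconj R).
Proof. by move=> q; apply: quatP; rewrite /qconj !quat_linE ?opprK. Qed.

(** Differentiability comes from the rational closed form, the equation from
    its axial form in the plane of [r]. *)
Lemma fueter_regular_KBF_halfball r : halfball4 r ->
  fueter_regular (@halfball4 R) (fun q => KBF_halfball q r).
Proof.
move=> hr q hq.
have closed : \near q,
    bf_kernel 1 (- qconj r) q + bf_kernel (qconj r) 1 q = KBF_halfball q r.
  apply: filterS (near_halfball4 hq) => x hx.
  by have [_ _ ->] := bergman_fueter_closed hx hr.
have [m1 m2] := qnorm_neq0 hq hr.
have cst (c : quat R) : differentiable (fun _ : quat R => c) q.
  exact: differentiable_cst.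
split.
  apply: near_eq_differentiable closed _; apply: differentiableD.
    exact: (differentiable_bf_kernel (cst _) (cst _) (differentiable_quat_id q) m1).
  exact: (differentiable_bf_kernel (cst _) (cst _) (differentiable_quat_id q) m2).
set J := iunit r; have SJ : imsphere J by exact: imsphere_iunit.
have [z [rE hz]] := halfball4_qconj hr; rewrite -/J in rE hz.
pose f x := axial J (lapA 1 (- z)) (lapB 1 (- z)) x
            + axial J (lapA z 1) (lapB z 1) x.
have fE : \near q, KBF_halfball q r = f q.
  apply: filterS closed => x <-.
  have a1 := axial_bf_kernel 1 (- z) x SJ; rewrite slice_emb1 slice_embN -rE in a1.
  have a2 := axial_bf_kernel z 1 x SJ; rewrite slice_emb1 -rE in a2.
  by rewrite /f a1 a2.
have dE w : 'D_w (fun q => KBF_halfball q r) q = 'D_w f q.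
  exact: near_eq_derive.
rewrite (dE 1) (dE (qi R)) (dE (qj R)) (dE (qk R)).
apply: dirac_kernelD.
- exact: halfball4_knorm_disk SJ hq hz.
- exact: halfball4_knorm_halfplane SJ hq hz.
Qed.

(** Conjugating [A + v B] gives [conj A + conj B * conj v] on the plane [C_I],
    and [conj A], [conj B] are the same rational functions evaluated at the
    conjugate parameters, that is, holomorphic functions of [r]. *)
Lemma slice_antiregular_KBF_halfball q : halfball4 q ->
  slice_antiregular (@halfball4 R) (fun r => KBF_halfball q r).
Proof.
move=> hq; split.
  move=> r hr.
  have closed : \near r,
      qconj (bf_kernel 1 (- qconj r) q + bf_kernel (qconj r) 1 q) =
      qconj (KBF_halfball q r).
    apply: filterS (near_halfball4 hr) => x hx.
    by have [_ _ ->] := bergman_fueter_closed hq hx.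
  have [m1 m2] := qnorm_neq0 hq hr.
  have cst (c : quat R) : differentiable (fun _ : quat R => c) r.
    exact: differentiable_cst.
  have dc := differentiable_qconj (differentiable_quat_id r).
  apply: near_eq_differentiable closed _; apply: differentiable_qconj.
  apply: differentiableD.
    exact: (differentiable_bf_kernel (cst _) (differentiableN dc) (cst _) m1).
  exact: (differentiable_bf_kernel dc (cst _) (cst _) m2).
move=> I x y SI hxy.
pose a (z : R[i]) := lapA 1 (- z) q + lapA z 1 q.
pose b (z : R[i]) := lapB 1 (- z) q + lapB z 1 q.
pose F (z : R[i]) := slice_emb I (a z) + slice_emb I (b z) * qconj (qim q).
have FE z : halfball4 (slice_emb I z) ->
    F z = qconj (KBF_halfball q (slice_emb I z)).
  move=> hz; have [_ _ ->] := bergman_fueter_closed hq hz.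
  have a1 := axial_bf_kernel 1 (- (z^*)%C) q SI.
  rewrite slice_emb1 slice_embN slice_emb_conj // in a1.
  have a2 := axial_bf_kernel (z^*)%C 1 q SI.
  rewrite slice_emb1 slice_emb_conj // in a2.
  rewrite -a1 -a2 axialD /axial.
  have -> : lapA 1 (- (z^*)%C) q + lapA (z^*)%C 1 q = ((a z)^*)%C.
    by rewrite /a rmorphD /= !conj_lapA rmorphN rmorph1.
  have -> : lapB 1 (- (z^*)%C) q + lapB (z^*)%C 1 q = ((b z)^*)%C.
    by rewrite /b rmorphD /= !conj_lapB rmorphN rmorph1.
  rewrite !slice_emb_conj // qconjD qconjM !qconjK.
  reflexivity.
have hz0 : halfball4 (slice_emb I (Complex x y)) by exact: hxy.
have n1 : knorm 1 (- Complex x y) q != 0 := halfball4_knorm_disk SI hq hz0.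
have n2 : knorm (Complex x y) 1 q != 0 := halfball4_knorm_halfplane SI hq hz0.
have id_ := holo_id (Complex x y); have cst1 := holo_cst 1 (Complex x y).
have ha : holo a (Complex x y).
  by apply: holoD; [exact: (holo_lapA cst1 (holoN id_) n1)|
                    exact: (holo_lapA id_ cst1 n2)].
have hb : holo b (Complex x y).
  by apply: holoD; [exact: (holo_lapB cst1 (holoN id_) n1)|
                    exact: (holo_lapB id_ cst1 n2)].
have along (c : R -> R[i]) t dc : c t = Complex x y -> is_cderive t 1 c dc ->
    (fun s => qconj (KBF_halfball q (slice_emb I (c s))))^`()%classic t =
    (fun s => F (c s))^`()%classic t.
  move=> ct hc; rewrite !derive1E; apply: near_eq_derive.
  have /derivable1_diffP/differentiable_continuous cont :
    derivable (fun s => slice_emb I (c s)) t 1.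
    by have [] := is_derive_slice_emb I hc.
  have hz1 : halfball4 (slice_emb I (c t)) by rewrite ct.
  have h : \near t, halfball4 (slice_emb I (c t)).
    exact: cont (near_halfball4 hz1).
  by apply: filterS h => s hs; rewrite FE.
have cx : is_cderive x 1 (fun t => Complex t y) 1.
  by split; [exact: is_derive_id|exact: is_derive_cst].
have cy : is_cderive y 1 (fun t => Complex x t) 'i%C.
  by split; [exact: is_derive_cst|exact: is_derive_id].
have e1 := along _ x _ erefl cx; have e2 := along _ y _ erefl cy.
have e := etrans (congr2 (fun u v => u + I * v) e1 e2)
  (cauchy_riemann_slice (qconj (qim q)) SI ha hb).
exact e.
Qed.

End BergmanFueter.

Theorem theorem6p13 (R : realType) :
  (forall q r : quat R, halfball4 q -> halfball4 r ->
     KBF_halfball q r = KBF_ball q r + KBF_halfspace q r) /\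
  (forall r : quat R, halfball4 r ->
     fueter_regular (@halfball4 R) (fun q => KBF_halfball q r)) /\
  (forall q : quat R, halfball4 q ->
     slice_antiregular (@halfball4 R) (fun r => KBF_halfball q r)).
Proof.
split; last split.
- by move=> q r hq hr; have [-> -> ->] := bergman_fueter_closed hq hr.
- exact: fueter_regular_KBF_halfball.
- exact: slice_antiregular_KBF_halfball.
Qed.
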